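(* Let $\mathcal{C}$ be the Cesàro operator on $H^2(\mathbb{D})$. Every closed invariant subspace for $\mathcal{C}$ is also an invariant subspace for $\mathcal{C}^\beta$ for every $\beta\in\mathbb{C}$ with $\operatorname{Re}\beta>0$. Moreover, for every $n=1,2,\ldots$, the operators $\mathcal{C}$ and $\mathcal{C}^{1/n}$ have the same lattice of closed invariant subspaces.
   Context: $\mathbb{D}$ is the open unit disc and $H^2(\mathbb{D})$ is the Hardy space with orthonormal basis $(z^n)_{n\ge0}$. The Cesàro operator is the bounded operator on $H^2(\mathbb{D})$ given, for $f(z)=\sum_{k\ge0} a_k z^k$, by $\mathcal{C}f(z)=\sum_{n=0}^\infty\big(\frac{1}{n+1}\sum_{k=0}^n a_k\big)z^n$. Let $\varphi_t(z)=e^{-t}z+1-e^{-t}$, $t\ge0$, and $C_{\varphi_t}f=f\circ\varphi_t$; these form a $C_0$-semigroup on $H^2(\mathbb{D})$ with $\|C_{\varphi_t}\|=e^{t/2}$ and generator $Af(z)=(1-z)f'(z)$, and $\mathcal{C}^*=(I-A)^{-1}$, so $\mathcal{C}=(I-A^* )^{-1}$. For $\operatorname{Re}\beta>0$, the power $\mathcal{C}^\beta=(I-A^* )^{-\beta}$ is defined by $$\mathcal{C}^\beta f=\frac{1}{\Gamma(\beta)}\int_0^\infty e^{-t}\,t^{\beta-1}\,C_{\varphi_t}^*f\,dt\qquad(f\in H^2(\mathbb{D})),$$ where $C_{\varphi_t}^*$ is the Hilbert space adjoint. *)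

(* Defs.v *)
From Stdlib Require Import Reals Lra Lia Psatz.
From Stdlib Require Import FunctionalExtensionality PropExtensionality.
From Stdlib Require Import ProofIrrelevance ClassicalEpsilon.
From Coquelicot Require Import Coquelicot.
Open Scope R_scope.

Lemma pos_series_bounded (u : nat -> R) (M : R) :
  (forall n, 0 <= u n) -> (forall N, sum_n u N <= M) ->
  ex_series u /\ Series u <= M.
Proof.
intros Hu HM.
assert (Hl : ex_finite_lim_seq (sum_n u)).
{ apply ex_finite_lim_seq_incr with M; auto.
  intros n; rewrite sum_Sn; unfold plus; simpl; generalize (Hu (S n)); lra. }
destruct Hl as [l Hl].
assert (Hs : is_series u l) by exact Hl.
split; [now exists l|].
rewrite (is_series_unique u l Hs).
apply (is_lim_seq_le (sum_n u) (fun _ => M) l M); auto.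
apply is_lim_seq_const.
Qed.

Lemma pos_series_partial (u : nat -> R) (N : nat) :
  (forall n, 0 <= u n) -> ex_series u -> sum_n u N <= Series u.
Proof.
intros Hu [l Hl]; rewrite (is_series_unique u l Hl).
apply (is_lim_seq_incr_compare (sum_n u) l); [exact Hl|].
intros n; rewrite sum_Sn; unfold plus; simpl; generalize (Hu (S n)); lra.
Qed.

Lemma pos_series_term (u : nat -> R) (n : nat) :
  (forall n, 0 <= u n) -> ex_series u -> u n <= Series u.
Proof.
intros Hu Hs; apply Rle_trans with (sum_n u n); [|now apply pos_series_partial].
assert (Hp : forall k, 0 <= sum_n u k).
{ induction k as [|k IH]; [rewrite sum_O; auto|].
  rewrite sum_Sn; unfold plus; simpl; generalize (Hu (S k)); lra. }
destruct n as [|n]; [rewrite sum_O; lra|].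
rewrite sum_Sn; unfold plus; simpl; generalize (Hp n); lra.
Qed.

Lemma sqr_plus_le (x y l : R) : 0 < l ->
  (x + y) ^ 2 <= (1 + l) * x ^ 2 + (1 + / l) * y ^ 2.
Proof.
intros Hl.
assert (H : (1 + l) * x ^ 2 + (1 + / l) * y ^ 2 - (x + y) ^ 2
            = / l * (l * x - y) ^ 2) by (field; lra).
assert (0 < / l) by now apply Rinv_0_lt_compat.
generalize (pow2_ge_0 (l * x - y)); nra.
Qed.

Definition sqsum (a : nat -> C) : Prop := ex_series (fun n => Cmod (a n) ^ 2).

Definition l2norm (a : nat -> C) : R := sqrt (Series (fun n => Cmod (a n) ^ 2)).

Lemma sqC_ge0 (a : nat -> C) (n : nat) : 0 <= Cmod (a n) ^ 2.
Proof. apply pow2_ge_0. Qed.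

Lemma sqseries_ge0 (a : nat -> C) :
  sqsum a -> 0 <= Series (fun n => Cmod (a n) ^ 2).
Proof.
intros Ha; apply Rle_trans with (Cmod (a O) ^ 2); [apply sqC_ge0|].
apply (pos_series_term (fun n => Cmod (a n) ^ 2) O); auto; apply sqC_ge0.
Qed.

Lemma l2norm_ge0 (a : nat -> C) : 0 <= l2norm a.
Proof. apply sqrt_pos. Qed.

Lemma l2norm_sqr (a : nat -> C) :
  sqsum a -> l2norm a ^ 2 = Series (fun n => Cmod (a n) ^ 2).
Proof. intros Ha; apply pow2_sqrt, sqseries_ge0, Ha. Qed.

Lemma sqsum_zero : sqsum (fun _ => RtoC 0).
Proof.
apply (pos_series_bounded _ 0).
- intros n; apply pow2_ge_0.
- intros N; rewrite sum_n_const, Cmod_0; lra.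
Qed.

Lemma l2norm_zero : l2norm (fun _ => RtoC 0) = 0.
Proof.
unfold l2norm; transitivity (sqrt 0); [f_equal|apply sqrt_0].
apply Rle_antisym; [|exact (sqseries_ge0 _ sqsum_zero)].
apply (pos_series_bounded _ 0).
- intros n; apply pow2_ge_0.
- intros N; rewrite sum_n_const, Cmod_0; lra.
Qed.

Lemma sqsum_scal (c : C) (a : nat -> C) :
  sqsum a -> sqsum (fun n => (c * a n)%C).
Proof.
intros Ha.
apply ex_series_ext with (fun n => scal (Cmod c ^ 2) (Cmod (a n) ^ 2)).
- intros n; rewrite Cmod_mult; unfold scal; simpl; unfold mult; simpl; ring.
- now apply @ex_series_scal.
Qed.

Lemma l2norm_scal (c : C) (a : nat -> C) :
  l2norm (fun n => (c * a n)%C) = Cmod c * l2norm a.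
Proof.
unfold l2norm.
rewrite (Series_ext _ (fun n => Cmod c ^ 2 * Cmod (a n) ^ 2)).
2: intros n; rewrite Cmod_mult; ring.
rewrite Series_scal_l, sqrt_mult_alt by apply pow2_ge_0.
now rewrite sqrt_pow2 by apply Cmod_ge_0.
Qed.

Lemma l2_plus_aux (a b : nat -> C) (l : R) : 0 < l -> sqsum a -> sqsum b ->
  sqsum (fun n => (a n + b n)%C) /\
  Series (fun n => Cmod (a n + b n)%C ^ 2)
    <= (1 + l) * l2norm a ^ 2 + (1 + / l) * l2norm b ^ 2.
Proof.
intros Hl Ha Hb.
assert (Hle : forall n, 0 <= Cmod (a n + b n)%C ^ 2
  <= (1 + l) * Cmod (a n) ^ 2 + (1 + / l) * Cmod (b n) ^ 2).
{ intros n; split; [apply pow2_ge_0|].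
  apply Rle_trans with ((Cmod (a n) + Cmod (b n)) ^ 2).
  - apply pow_incr; split; [apply Cmod_ge_0|apply Cmod_triangle].
  - now apply sqr_plus_le. }
assert (Ha' : ex_series (fun n => (1 + l) * Cmod (a n) ^ 2))
  by now apply @ex_series_scal.
assert (Hb' : ex_series (fun n => (1 + / l) * Cmod (b n) ^ 2))
  by now apply @ex_series_scal.
assert (Hab : ex_series
  (fun n => (1 + l) * Cmod (a n) ^ 2 + (1 + / l) * Cmod (b n) ^ 2))
  by now apply @ex_series_plus.
split.
- refine (ex_series_le (K := R_AbsRing) (V := R_CompleteNormedModule)
    _ _ _ Hab).
  intros n; unfold norm; simpl; unfold abs; simpl.
  rewrite Rabs_pos_eq; apply Hle.
- rewrite !l2norm_sqr by assumption.
  rewrite <- !Series_scal_l, <- Series_plus by assumption.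
  now apply Series_le.
Qed.

Lemma sqsum_plus (a b : nat -> C) :
  sqsum a -> sqsum b -> sqsum (fun n => (a n + b n)%C).
Proof. intros Ha Hb; now apply (l2_plus_aux a b 1 Rlt_0_1). Qed.

Lemma l2norm_triangle (a b : nat -> C) : sqsum a -> sqsum b ->
  l2norm (fun n => (a n + b n)%C) <= l2norm a + l2norm b.
Proof.
intros Ha Hb.
apply le_epsilon; intros e He.
set (x := l2norm a + e / 2); set (y := l2norm b + e / 2).
assert (Hx : 0 < x) by (unfold x; generalize (l2norm_ge0 a); lra).
assert (Hy : 0 < y) by (unfold y; generalize (l2norm_ge0 b); lra).
replace (l2norm a + l2norm b + e) with (x + y) by (unfold x, y; lra).
assert (Hl : 0 < y / x) by now apply Rdiv_lt_0_compat.
destruct (l2_plus_aux a b (y / x) Hl Ha Hb) as [_ H].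
rewrite <- (sqrt_pow2 (x + y)) by lra.
apply sqrt_le_1_alt.
apply Rle_trans with (1 := H).
assert (Hax : l2norm a ^ 2 <= x ^ 2).
{ apply pow_incr; split; [apply l2norm_ge0|unfold x; lra]. }
assert (Hby : l2norm b ^ 2 <= y ^ 2).
{ apply pow_incr; split; [apply l2norm_ge0|unfold y; lra]. }
assert (Hl' : 0 < / (y / x)) by now apply Rinv_0_lt_compat.
apply Rle_trans with ((1 + y / x) * x ^ 2 + (1 + / (y / x)) * y ^ 2).
- apply Rplus_le_compat; apply Rmult_le_compat_l; lra.
- apply Req_le; field; lra.
Qed.

Lemma l2norm_term (a : nat -> C) (n : nat) : sqsum a -> Cmod (a n) <= l2norm a.
Proof.
intros Ha; rewrite <- (sqrt_pow2 (Cmod (a n))) by apply Cmod_ge_0.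
apply sqrt_le_1_alt.
apply (pos_series_term (fun n => Cmod (a n) ^ 2)); auto; apply sqC_ge0.
Qed.

Lemma pow_n_RtoC (x : R) (n : nat) :
  @pow_n C_Ring (RtoC x) n = RtoC (x ^ n).
Proof.
induction n as [|n IH]; [reflexivity|].
simpl; rewrite IH; unfold mult; simpl; now rewrite RtoC_mult.
Qed.

Lemma Cmod_pow_n (z : C) (n : nat) : Cmod (@pow_n C_Ring z n) = Cmod z ^ n.
Proof.
induction n as [|n IH]; [apply Cmod_1|].
simpl; unfold mult at 1; simpl; now rewrite Cmod_mult, IH.
Qed.

Lemma sqsum_ex_pseries (a : nat -> C) (z : C) :
  sqsum a -> Cmod z < 1 -> ex_pseries a z.
Proof.
intros Ha Hz.
apply (ex_series_le (K := C_AbsRing) (V := C_CompleteNormedModule) _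
  (fun n => Cmod (a n) ^ 2 + (Cmod z ^ 2) ^ n)).
- intros n; change (Cmod (@pow_n C_Ring z n * a n)%C
    <= Cmod (a n) ^ 2 + (Cmod z ^ 2) ^ n).
  rewrite Cmod_mult, Cmod_pow_n.
  rewrite <- pow_mult, Nat.mul_comm, pow_mult.
  generalize (pow2_ge_0 (Cmod z ^ n - Cmod (a n)))
    (pow2_ge_0 (Cmod z ^ n + Cmod (a n))); nra.
- apply (@ex_series_plus R_AbsRing R_NormedModule); [exact Ha|].
  apply ex_series_geom; generalize (Cmod_ge_0 z); intros H0.
  rewrite Rabs_pos_eq by apply pow2_ge_0; nra.
Qed.

Definition Cpart (i : bool) (z : C) : R := if i then fst z else snd z.

Lemma sum_n_Cpart (i : bool) (u : nat -> C) (n : nat) :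
  Cpart i (sum_n (G := C_AbelianMonoid) u n) = sum_n (fun k => Cpart i (u k)) n.
Proof.
induction n as [|n IH]; [now rewrite !sum_O|].
rewrite !sum_Sn, <- IH; now destruct i.
Qed.

Lemma is_series_Cpart (i : bool) (u : nat -> C) (l : C) :
  is_series (K := C_AbsRing) (V := C_NormedModule) u l ->
  is_series (fun n => Cpart i (u n)) (Cpart i l).
Proof.
intros H.
assert (H' : filterlim (fun n => Cpart i (sum_n (G := C_AbelianMonoid) u n))
  eventually (locally (Cpart i l))).
{ apply filterlim_comp with (locally l); [exact H|].
  intros P [e He]; exists e; intros z [Hz1 Hz2]; apply He.
  destruct i; assumption. }
refine (filterlim_ext _ _ _ H'); intros n; apply sum_n_Cpart.
Qed.

Lemma CV_radius_Cpart (i : bool) (a : nat -> C) :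
  sqsum a -> Rbar_lt 0 (CV_radius (fun n => Cpart i (a n))).
Proof.
intros Ha.
apply Rbar_lt_le_trans with (Finite 1); [simpl; lra|].
apply Rbar_not_lt_le; intros Hr.
rewrite <- Rabs_R1 in Hr.
apply (CV_disk_outside _ _ Hr).
assert (H2 : is_lim_seq (fun n => Cmod (a n)) 0).
{ apply is_lim_seq_spec; intros e.
  assert (He : 0 < e ^ 2) by (apply pow_lt, cond_pos).
  generalize (ex_series_lim_0 _ Ha); rewrite <- is_lim_seq_spec.
  intros H; destruct (H (mkposreal _ He)) as [N HN]; exists N; intros n Hn.
  specialize (HN n Hn); simpl in HN; rewrite Rminus_0_r in *.
  rewrite Rabs_pos_eq in HN by (generalize (sqC_ge0 a n); simpl; lra).
  rewrite Rabs_pos_eq by apply Cmod_ge_0.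
  generalize (Cmod_ge_0 (a n)) (cond_pos e); nra. }
apply is_lim_seq_abs_0.
apply is_lim_seq_le_le with (fun _ => 0) (fun n => Cmod (a n)).
- intros n; split; [apply Rabs_pos|].
  rewrite pow1, Rmult_1_r.
  apply Rle_trans with (2 := Rmax_Cmod (a n)).
  destruct i; [apply Rmax_l|apply Rmax_r].
- apply is_lim_seq_const.
- exact H2.
Qed.

Lemma sqsum_pseries_inj (a b : nat -> C) (f : C -> C) : sqsum a -> sqsum b ->
  (forall z, Cmod z < 1 -> is_pseries a z (f z)) ->
  (forall z, Cmod z < 1 -> is_pseries b z (f z)) ->
  a = b.
Proof.
intros Ha Hb Hfa Hfb; apply functional_extensionality; intros n.
assert (Hp : forall i (c : nat -> C) x,
  (forall z, Cmod z < 1 -> is_pseries c z (f z)) -> Rabs x < 1 ->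
  PSeries (fun n => Cpart i (c n)) x = Cpart i (f (RtoC x))).
{ intros i c x Hc Hx.
  apply is_pseries_unique; unfold is_pseries.
  rewrite <- Cmod_R in Hx.
  generalize (is_series_Cpart i _ _ (Hc _ Hx)); apply is_series_ext.
  intros k; change (Cpart i (@pow_n C_Ring (RtoC x) k * c k)%C
    = @pow_n R_Ring x k * Cpart i (c k)).
  replace (@pow_n R_Ring x k) with (x ^ k) by (symmetry; apply pow_n_pow).
  rewrite (pow_n_RtoC x k); destruct i; simpl; ring. }
assert (He : forall i, Cpart i (a n) = Cpart i (b n)).
{ intros i.
  apply (PSeries_ext_recip (fun n => Cpart i (a n)) (fun n => Cpart i (b n)) n);
    try (apply CV_radius_Cpart; assumption).
  exists (mkposreal 1 Rlt_0_1); intros x Hx.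
  assert (Hx' : Rabs x < 1).
  { replace x with (x - 0) by ring; exact Hx. }
  now rewrite !Hp. }
generalize (He true) (He false); simpl.
destruct (a n), (b n); simpl; congruence.
Qed.

(** Functions on the disc are represented by functions on [C] vanishing outside
    it, so that equality in [H2] is equality of functions on the disc. *)
Record H2 : Type := mkH2 {
  H2_fun :> C -> C;
  H2_out : forall z, 1 <= Cmod z -> H2_fun z = 0;
  H2_taylor : exists a : nat -> C, sqsum a /\
    forall z, Cmod z < 1 -> is_pseries a z (H2_fun z)
}.

Lemma H2_ext (f g : H2) : (forall z, Cmod z < 1 -> f z = g z) -> f = g.
Proof.
intros H.
assert (E : H2_fun f = H2_fun g).
{ apply functional_extensionality; intros z.
  destruct (Rlt_le_dec (Cmod z) 1) as [Hz|Hz]; [now apply H|].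
  now rewrite !H2_out. }
destruct f as [f f1 f2], g as [g g1 g2]; simpl in E; subst g.
f_equal; apply proof_irrelevance.
Qed.

Definition taylor (f : H2) : nat -> C :=
  proj1_sig (constructive_indefinite_description _ (H2_taylor f)).

Lemma taylor_sqsum (f : H2) : sqsum (taylor f).
Proof.
unfold taylor; destruct (constructive_indefinite_description _ _) as [a Ha].
apply Ha.
Qed.

Lemma taylor_pseries (f : H2) (z : C) :
  Cmod z < 1 -> is_pseries (taylor f) z (f z).
Proof.
unfold taylor; destruct (constructive_indefinite_description _ _) as [a Ha].
apply Ha.
Qed.

Lemma taylor_unique (f : H2) (a : nat -> C) : sqsum a ->
  (forall z, Cmod z < 1 -> is_pseries a z (f z)) -> taylor f = a.
Proof.
intros Ha Hf; apply (sqsum_pseries_inj _ _ f); auto.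
- apply taylor_sqsum.
- apply taylor_pseries.
Qed.

Lemma taylor_inj (f g : H2) : taylor f = taylor g -> f = g.
Proof.
intros H; apply H2_ext; intros z Hz.
generalize (taylor_pseries f z Hz) (taylor_pseries g z Hz); rewrite H.
apply filterlim_locally_unique.
Qed.

Lemma H2_of_taylor_ex (a : nat -> C) : sqsum a -> exists f : H2, taylor f = a.
Proof.
intros Ha.
assert (Hex : forall z, exists w : C,
  (1 <= Cmod z -> w = 0) /\ (Cmod z < 1 -> is_pseries a z w)).
{ intros z; destruct (Rlt_le_dec (Cmod z) 1) as [Hz|Hz].
  - destruct (sqsum_ex_pseries a z Ha Hz) as [w Hw].
    exists w; split; [lra|auto].
  - exists 0; split; [auto|lra]. }
set (F := fun z => proj1_sig (constructive_indefinite_description _ (Hex z))).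
assert (HF : forall z,
  (1 <= Cmod z -> F z = 0) /\ (Cmod z < 1 -> is_pseries a z (F z))).
{ intros z; unfold F; apply proj2_sig. }
exists (mkH2 F (fun z => proj1 (HF z))
  (ex_intro _ a (conj Ha (fun z => proj2 (HF z))))).
apply taylor_unique; [exact Ha|exact (fun z => proj2 (HF z))].
Qed.

Lemma H2_plus_taylor (f g : H2) (z : C) : Cmod z < 1 ->
  is_pseries (fun n => (taylor f n + taylor g n)%C) z (f z + g z)%C.
Proof.
intros Hz; exact (is_pseries_plus _ _ _ _ _
  (taylor_pseries f z Hz) (taylor_pseries g z Hz)).
Qed.

Lemma H2_scal_taylor (c : C) (f : H2) (z : C) : Cmod z < 1 ->
  is_pseries (fun n => (c * taylor f n)%C) z (c * f z)%C.
Proof.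
intros Hz.
apply (is_pseries_scal c (taylor f) z (f z)); [apply Cmult_comm|].
now apply taylor_pseries.
Qed.

Lemma H2_zero_taylor (z : C) :
  Cmod z < 1 -> is_pseries (fun _ => RtoC 0) z (RtoC 0).
Proof.
intros _; unfold is_pseries, is_series.
apply filterlim_ext with (fun _ : nat => RtoC 0); [|apply filterlim_const].
intros n; induction n as [|n IH].
- rewrite sum_O; unfold scal; simpl; unfold mult; simpl; now rewrite Cmult_0_r.
- rewrite sum_Sn, <- IH; unfold scal; simpl; unfold mult, plus; simpl.
  now rewrite Cmult_0_r, Cplus_0_r.
Qed.

Definition H2_zero : H2.
Proof.
refine (mkH2 (fun _ => RtoC 0) (fun _ _ => eq_refl) _).
exists (fun _ => RtoC 0); split; [apply sqsum_zero|apply H2_zero_taylor].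
Defined.

Definition H2_plus (f g : H2) : H2.
Proof.
refine (mkH2 (fun z => f z + g z)%C _ _).
- abstract (intros z Hz; rewrite !H2_out by exact Hz; apply Cplus_0_r).
- abstract (exists (fun n => taylor f n + taylor g n)%C; split;
    [apply sqsum_plus; apply taylor_sqsum|apply H2_plus_taylor]).
Defined.

Definition H2_scal (c : C) (f : H2) : H2.
Proof.
refine (mkH2 (fun z => c * f z)%C _ _).
- abstract (intros z Hz; rewrite H2_out by exact Hz; apply Cmult_0_r).
- abstract (exists (fun n => c * taylor f n)%C; split;
    [apply sqsum_scal, taylor_sqsum|apply H2_scal_taylor]).
Defined.

Definition H2_opp (f : H2) : H2 := H2_scal (- (1))%C f.

Lemma taylor_zero : taylor H2_zero = fun _ => RtoC 0.
Proof. apply taylor_unique; [apply sqsum_zero|apply H2_zero_taylor]. Qed.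

Lemma taylor_plus (f g : H2) :
  taylor (H2_plus f g) = fun n => (taylor f n + taylor g n)%C.
Proof.
apply taylor_unique; [apply sqsum_plus; apply taylor_sqsum|].
apply H2_plus_taylor.
Qed.

Lemma taylor_scal (c : C) (f : H2) :
  taylor (H2_scal c f) = fun n => (c * taylor f n)%C.
Proof.
apply taylor_unique; [apply sqsum_scal, taylor_sqsum|].
apply H2_scal_taylor.
Qed.

Definition H2_AbelianMonoid_mixin : AbelianMonoid.mixin_of H2.
Proof.
apply (AbelianMonoid.Mixin H2 H2_plus H2_zero); intros; apply H2_ext;
  intros ? _; simpl; ring.
Defined.

Canonical H2_AbelianMonoid := AbelianMonoid.Pack H2 H2_AbelianMonoid_mixin H2.

Definition H2_AbelianGroup_mixin : AbelianGroup.mixin_of H2_AbelianMonoid.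
Proof.
apply (AbelianGroup.Mixin H2_AbelianMonoid H2_opp); intros; apply H2_ext;
  intros ? _; simpl; ring.
Defined.

Canonical H2_AbelianGroup :=
  AbelianGroup.Pack H2 (AbelianGroup.Class _ _ H2_AbelianGroup_mixin) H2.

Definition H2_ModuleSpace_mixin : ModuleSpace.mixin_of C_Ring H2_AbelianGroup.
Proof.
apply (ModuleSpace.Mixin C_Ring H2_AbelianGroup H2_scal); intros; apply H2_ext;
  intros ? _; simpl; unfold mult, one, plus; simpl; ring.
Defined.

Canonical H2_ModuleSpace := ModuleSpace.Pack C_Ring H2
  (ModuleSpace.Class _ _ (AbelianGroup.class H2_AbelianGroup)
     H2_ModuleSpace_mixin) H2.

Lemma taylor_minus (f g : H2) :
  taylor (minus f g) = fun n => (taylor f n - taylor g n)%C.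
Proof.
change (taylor (H2_plus f (H2_opp g)) = fun n => (taylor f n - taylor g n)%C).
unfold H2_opp; rewrite taylor_plus, taylor_scal.
apply functional_extensionality; intros n; ring.
Qed.

Definition H2_norm (f : H2) : R := l2norm (taylor f).

Definition H2_ball (f : H2) (e : R) (g : H2) : Prop := H2_norm (minus g f) < e.

Lemma H2_norm_zero : H2_norm H2_zero = 0.
Proof. unfold H2_norm; rewrite taylor_zero; apply l2norm_zero. Qed.

Lemma H2_norm_triangle (f g : H2) :
  H2_norm (H2_plus f g) <= H2_norm f + H2_norm g.
Proof.
unfold H2_norm; rewrite taylor_plus.
apply l2norm_triangle; apply taylor_sqsum.
Qed.

Lemma H2_norm_scal (c : C) (f : H2) :
  H2_norm (H2_scal c f) = Cmod c * H2_norm f.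
Proof. unfold H2_norm; rewrite taylor_scal; apply l2norm_scal. Qed.

Lemma H2_norm_eq0 (f : H2) : H2_norm f = 0 -> f = H2_zero.
Proof.
intros H; apply taylor_inj; rewrite taylor_zero.
apply functional_extensionality; intros n; apply Cmod_eq_0.
apply Rle_antisym; [|apply Cmod_ge_0].
rewrite <- H; apply l2norm_term, taylor_sqsum.
Qed.

Definition H2_UniformSpace_mixin : UniformSpace.mixin_of H2.
Proof.
apply (UniformSpace.Mixin H2 H2_zero H2_ball); unfold H2_ball.
- intros f e; rewrite minus_eq_zero.
  change (H2_norm H2_zero < e); rewrite H2_norm_zero; apply cond_pos.
- intros f g e H; rewrite <- opp_minus.
  change (H2_norm (H2_scal (- (1))%C (minus g f)) < e).
  now rewrite H2_norm_scal, Cmod_opp, Cmod_1, Rmult_1_l.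
- intros f g h e1 e2 H1 Hn2; rewrite (minus_trans g).
  apply Rle_lt_trans with (1 := H2_norm_triangle _ _); lra.
Defined.

Canonical H2_UniformSpace := UniformSpace.Pack H2 H2_UniformSpace_mixin H2.

Canonical H2_NormedModuleAux := NormedModuleAux.Pack C_AbsRing H2
  (NormedModuleAux.Class C_AbsRing H2 (ModuleSpace.class _ H2_ModuleSpace)
     (UniformSpace.class H2_UniformSpace)) H2.

Definition H2_NormedModule_mixin :
  NormedModule.mixin_of C_AbsRing H2_NormedModuleAux.
Proof.
apply (NormedModule.Mixin C_AbsRing H2_NormedModuleAux H2_norm 1).
- exact H2_norm_triangle.
- intros c f; apply Req_le, H2_norm_scal.
- intros f g e H; exact H.
- intros f g e H; rewrite Rmult_1_l; exact H.
- exact H2_norm_eq0.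
Defined.

Canonical H2_NormedModule := NormedModule.Pack C_AbsRing H2
  (NormedModule.Class C_AbsRing H2
     (NormedModuleAux.class _ H2_NormedModuleAux) H2_NormedModule_mixin) H2.

Definition H2_lim_taylor (F : (H2 -> Prop) -> Prop) (n : nat) : C :=
  C_complete_lim (fun P => F (fun f => P (taylor f n))).

Lemma H2_lim_ex (F : (H2 -> Prop) -> Prop) :
  exists f : H2, sqsum (H2_lim_taylor F) -> taylor f = H2_lim_taylor F.
Proof.
destruct (classic (sqsum (H2_lim_taylor F))) as [H|H].
- destruct (H2_of_taylor_ex _ H) as [f Hf]; now exists f.
- exists H2_zero; contradiction.
Qed.

Definition H2_complete_lim (F : (H2 -> Prop) -> Prop) : H2 :=
  proj1_sig (constructive_indefinite_description _ (H2_lim_ex F)).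

Lemma Cmod_ball_le (x y : C) (e : R) : 0 < e -> ball x e y -> Cmod (y - x)%C <= 2 * e.
Proof.
intros He [H1 Hn2].
change (Rabs (fst y - fst x) < e) in H1.
change (Rabs (snd y - snd x) < e) in Hn2.
apply Rle_trans with (1 := Cmod_2Rmax _).
assert (Hs : sqrt 2 <= 2).
{ rewrite <- (sqrt_pow2 2) at 2 by lra; apply sqrt_le_1_alt; lra. }
apply Rmult_le_compat; auto using sqrt_pos.
- apply Rle_trans with (2 := Rmax_l _ _); apply Rabs_pos.
- apply Rmax_lub; simpl; unfold Rminus in *; lra.
Qed.

Lemma H2_lim_coef (F : (H2 -> Prop) -> Prop) : ProperFilter F -> cauchy F ->
  forall (d : posreal) (N : nat),
  F (fun g : H2 => forall n, (n <= N)%nat ->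
       Cmod (taylor g n - H2_lim_taylor F n)%C <= 2 * d).
Proof.
intros PF CF d N.
assert (H1 : forall n, F (fun g => Cmod (taylor g n - H2_lim_taylor F n)%C <= 2 * d)).
{ intros n.
  assert (HP : ProperFilter (fun P : C -> Prop => F (fun f : H2 => P (taylor f n)) : Prop)).
  { exact (filtermap_proper_filter H2 C (fun f : H2 => taylor f n) F PF). }
  assert (HC : forall e : posreal, exists x : C,
    F (fun f => ball x e (taylor f n))).
  { intros e; destruct (CF e) as [x Hx]; exists (taylor x n).
    revert Hx; apply filter_imp; intros g Hg.
    apply C_NormedModule_mixin_compat1.
    apply Rle_lt_trans with (2 := Hg).
    replace (minus (taylor g n) (taylor x n)) with (taylor (minus g x) n).
    - apply l2norm_term, taylor_sqsum.
    - now rewrite taylor_minus. }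
  generalize (C_complete_ax1 _ HP HC d); apply filter_imp; intros g Hg.
  apply Cmod_ball_le; [apply cond_pos|exact Hg]. }
induction N as [|N IH].
- generalize (H1 O); apply filter_imp; intros g Hg n Hn.
  now replace n with O by lia.
- generalize (filter_and _ _ IH (H1 (S N))); apply filter_imp.
  intros g [Hg1 Hg2] n Hn.
  destruct (Nat.eq_dec n (S N)) as [->|Hn']; [exact Hg2|apply Hg1; lia].
Qed.

Lemma H2_lim_near (F : (H2 -> Prop) -> Prop) (x : H2) (e : posreal) :
  ProperFilter F -> cauchy F -> F (ball x e) ->
  sqsum (fun n => H2_lim_taylor F n - taylor x n)%C /\
  l2norm (fun n => H2_lim_taylor F n - taylor x n)%C <= 2 * e.
Proof.
intros PF CF Hx; set (c := H2_lim_taylor F).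
destruct (pos_series_bounded (fun n => Cmod (c n - taylor x n)%C ^ 2) (4 * e ^ 2))
  as [H1 Hn2].
- intros n; apply pow2_ge_0.
- intros N; apply le_epsilon; intros t Ht.
  assert (HN : 0 < INR (S N)) by (apply lt_0_INR; lia).
  assert (Hd : 0 < sqrt (t / (8 * INR (S N)))).
  { apply sqrt_lt_R0, Rdiv_lt_0_compat; lra. }
  destruct (filter_ex _ (filter_and _ _ Hx
    (H2_lim_coef F PF CF (mkposreal _ Hd) N))) as [y [Hy1 Hy2]].
  simpl in Hy2; change (H2_norm (minus y x) < e) in Hy1.
  unfold H2_norm in Hy1; rewrite taylor_minus in Hy1.
  assert (Hs : sqsum (fun n => taylor y n - taylor x n)%C).
  { rewrite <- taylor_minus; apply taylor_sqsum. }
  apply Rle_trans with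
    (sum_n (fun n => 2 * Cmod (taylor y n - taylor x n)%C ^ 2
                     + t / INR (S N)) N).
  + assert (Hk : forall k, (k <= N)%nat ->
      sum_n (fun n => Cmod (c n - taylor x n)%C ^ 2) k <=
      sum_n (fun n => 2 * Cmod (taylor y n - taylor x n)%C ^ 2
                     + t / INR (S N)) k).
    { assert (Hn : forall n, (n <= N)%nat -> Cmod (c n - taylor x n)%C ^ 2
        <= 2 * Cmod (taylor y n - taylor x n)%C ^ 2 + t / INR (S N)).
      { intros n Hn; specialize (Hy2 n Hn); fold c in Hy2.
        set (p := Cmod (taylor y n - taylor x n)%C).
        set (q := Cmod (taylor y n - c n)%C) in *.
        assert (Hq : q ^ 2 <= t / (2 * INR (S N))).
        { apply Rle_trans with ((2 * sqrt (t / (8 * INR (S N)))) ^ 2).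
          - apply pow_incr; split; [apply Cmod_ge_0|exact Hy2].
          - rewrite Rpow_mult_distr, pow2_sqrt.
            + apply Req_le; field; lra.
            + apply Rlt_le, Rdiv_lt_0_compat; lra. }
        assert (Htri : Cmod (c n - taylor x n)%C <= p + q).
        { replace (c n - taylor x n)%C with
            ((taylor y n - taylor x n) + - (taylor y n - c n))%C by ring.
          apply Rle_trans with (1 := Cmod_triangle _ _).
          rewrite Cmod_opp; apply Rle_refl. }
        apply Rle_trans with ((p + q) ^ 2).
        - apply pow_incr; split; [apply Cmod_ge_0|exact Htri].
        - apply Rle_trans with (2 * p ^ 2 + 2 * q ^ 2).
          + generalize (pow2_ge_0 (p - q)); nra.
          + replace (t / INR (S N)) with (2 * (t / (2 * INR (S N))))
              by (field; lra).
            lra. }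
      induction k as [|k IH]; intros Hk.
      - rewrite !sum_O; apply Hn; lia.
      - rewrite !sum_Sn; apply Rplus_le_compat; [apply IH; lia|apply Hn; lia]. }
    now apply Hk.
  + rewrite (sum_n_plus (G := R_AbelianMonoid)
      (fun n => 2 * Cmod (taylor y n - taylor x n)%C ^ 2)
      (fun _ => t / INR (S N))).
    rewrite sum_n_const; unfold plus; simpl plus.
    rewrite (sum_n_mult_l (K := R_Ring) 2).
    apply Rplus_le_compat.
    * assert (Hp : sum_n (fun n => Cmod (taylor y n - taylor x n)%C ^ 2) N <= e ^ 2).
      { apply Rle_trans with (1 := pos_series_partial _ N (sqC_ge0 _) Hs).
        rewrite <- l2norm_sqr by exact Hs.
        apply pow_incr; split; [apply l2norm_ge0|now apply Rlt_le]. }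
      apply Rle_trans with (2 * e ^ 2); [|generalize (pow2_ge_0 e); lra].
      apply Rmult_le_compat_l; [lra|exact Hp].
    * apply Req_le; field; lra.
- split; [exact H1|].
  unfold l2norm; rewrite <- (sqrt_pow2 (2 * e)).
  + apply sqrt_le_1_alt; lra.
  + generalize (cond_pos e); lra.
Qed.

Definition H2_CompleteSpace_mixin : CompleteSpace.mixin_of H2_UniformSpace.
Proof.
apply (CompleteSpace.Mixin H2_UniformSpace H2_complete_lim).
- intros F PF CF e.
  assert (He : 0 < e / 3) by (generalize (cond_pos e); lra).
  destruct (CF (mkposreal _ He)) as [x Hx].
  destruct (H2_lim_near F x _ PF CF Hx) as [H1 Hn2]; simpl in Hn2.
  assert (Hc : sqsum (H2_lim_taylor F)).
  { generalize (sqsum_plus _ _ H1 (taylor_sqsum x)).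
    unfold sqsum; apply ex_series_ext; intros n; f_equal; f_equal; ring. }
  assert (Hl : taylor (H2_complete_lim F) = H2_lim_taylor F).
  { unfold H2_complete_lim.
    destruct (constructive_indefinite_description _ _) as [f Hf]; auto. }
  generalize Hx; apply filter_imp; intros y Hy.
  change (H2_norm (minus y x) < e / 3) in Hy.
  change (H2_norm (minus y (H2_complete_lim F)) < e).
  rewrite (minus_trans x).
  apply Rle_lt_trans with (1 := H2_norm_triangle _ _).
  assert (Hx2 : H2_norm (minus x (H2_complete_lim F)) <= 2 * (e / 3)); [|lra].
  rewrite <- opp_minus.
  change (H2_norm (H2_scal (- (1))%C (minus (H2_complete_lim F) x)) <= 2 * (e / 3)).
  rewrite H2_norm_scal, Cmod_opp, Cmod_1, Rmult_1_l.
  unfold H2_norm; rewrite taylor_minus, Hl; exact Hn2.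
- intros F1 F2 H12 H21.
  assert (E : F1 = F2).
  { apply functional_extensionality; intros P; apply propositional_extensionality.
    split; auto. }
  rewrite E; apply close_refl.
Defined.

Canonical H2_CompleteNormedModule := CompleteNormedModule.Pack C_AbsRing H2
  (CompleteNormedModule.Class C_AbsRing H2
     (NormedModule.class _ H2_NormedModule) H2_CompleteSpace_mixin) H2.

Canonical H2_CompleteSpace := CompleteSpace.Pack H2
  (CompleteSpace.Class H2 (UniformSpace.class H2_UniformSpace)
     H2_CompleteSpace_mixin) H2.

(** Vector-valued integrals live in normed modules over [R]. As for
    [C_R_NormedModule], these structures are not canonical, so that [scal] on
    [H2] is multiplication by complex scalars. *)
Definition H2_R_ModuleSpace_mixin : ModuleSpace.mixin_of R_Ring H2_AbelianGroup.
Proof.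
apply (ModuleSpace.Mixin R_Ring H2_AbelianGroup (fun r f => H2_scal (RtoC r) f));
  intros; apply H2_ext; intros ? _; simpl; unfold mult, one, plus; simpl;
  rewrite ?RtoC_mult, ?RtoC_plus; ring.
Defined.

Definition H2_R_ModuleSpace := ModuleSpace.Pack R_Ring H2
  (ModuleSpace.Class _ _ (AbelianGroup.class H2_AbelianGroup)
     H2_R_ModuleSpace_mixin) H2.

Definition H2_R_NormedModuleAux := NormedModuleAux.Pack R_AbsRing H2
  (NormedModuleAux.Class R_AbsRing H2 (ModuleSpace.class _ H2_R_ModuleSpace)
     (UniformSpace.class H2_UniformSpace)) H2.

Definition H2_R_NormedModule_mixin :
  NormedModule.mixin_of R_AbsRing H2_R_NormedModuleAux.
Proof.
apply (NormedModule.Mixin R_AbsRing H2_R_NormedModuleAux H2_norm 1).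
- exact H2_norm_triangle.
- intros r f; apply Req_le.
  change (H2_norm (H2_scal (RtoC r) f) = Rabs r * H2_norm f).
  now rewrite H2_norm_scal, Cmod_R.
- intros f g e H; exact H.
- intros f g e H; rewrite Rmult_1_l; exact H.
- exact H2_norm_eq0.
Defined.

Definition H2_R_NormedModule := NormedModule.Pack R_AbsRing H2
  (NormedModule.Class R_AbsRing H2
     (NormedModuleAux.class _ H2_R_NormedModuleAux) H2_R_NormedModule_mixin) H2.

Definition H2_R_CompleteNormedModule := CompleteNormedModule.Pack R_AbsRing H2
  (CompleteNormedModule.Class R_AbsRing H2
     (NormedModule.class _ H2_R_NormedModule) H2_CompleteSpace_mixin) H2.

Definition CSeries (a : nat -> C) : C :=
  (Series (fun n => Re (a n)), Series (fun n => Im (a n))).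

Definition H2_inner (f g : H2) : C :=
  CSeries (fun n => taylor f n * Cconj (taylor g n))%C.

(** [iota P] is the element of a complete space characterised by [P]; below it
    always designates an element that exists and is unique (for the adjoint,
    when [T] is linear and bounded). *)
Definition adjoint (T : H2 -> H2) (f : H2) : H2 :=
  iota (fun h : H2 => forall g : H2, H2_inner (T g) f = H2_inner g h).

Definition Cesaro_op (f : H2) : H2 :=
  iota (fun g : H2 => forall z : C, Cmod z < 1 ->
    is_pseries (fun n => / RtoC (INR (n + 1)) * sum_n (taylor f) n)%C z (g z)).

Definition phi (t : R) (z : C) : C :=
  (RtoC (exp (- t)) * z + 1 - RtoC (exp (- t)))%C.

Definition comp_op (h : C -> C) (f : H2) : H2 :=
  iota (fun g : H2 => forall z : C, Cmod z < 1 -> g z = f (h z)).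

Definition Cexp (z : C) : C := (RtoC (exp (Re z)) * (cos (Im z), sin (Im z)))%C.

(** Meant for [0 < t]. *)
Definition Rcpow (t : R) (s : C) : C := Cexp (s * RtoC (ln t))%C.

(** Improper at both ends: the integrands below may be singular at [0]. *)
Definition CGamma (s : C) : C :=
  RInt_gen (V := C_R_CompleteNormedModule)
    (fun t => RtoC (exp (- t)) * Rcpow t (s - 1))%C
    (at_right 0) (Rbar_locally p_infty).

(** The integral converges in the norm of [H2]; away from the end points the
    integrand is norm continuous, hence Riemann integrable. *)
Definition Cesaro_pow (beta : C) (f : H2) : H2 :=
  scal (/ CGamma beta)%C
    (RInt_gen (V := H2_R_CompleteNormedModule)
      (fun t => scal (RtoC (exp (- t)) * Rcpow t (beta - 1))%C
                  (adjoint (comp_op (phi t)) f))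
      (at_right 0) (Rbar_locally p_infty)).

Definition closed_subspace (M : H2 -> Prop) : Prop :=
  M zero /\
  (forall f g, M f -> M g -> M (plus f g)) /\
  (forall (c : C) f, M f -> M (scal c f)) /\
  closed M.

(** The order and lattice operations on closed invariant subspaces are those of
    inclusion, so the lattice is determined by its set of members. *)
Definition Lat (T : H2 -> H2) (M : H2 -> Prop) : Prop :=
  closed_subspace M /\ forall f, M f -> M (T f).

(* Main.v *)
Require Import Defs.
From Stdlib Require Import Arith Reals Lra Lia Psatz.
From Stdlib Require Import FunctionalExtensionality ClassicalEpsilon.
From Coquelicot Require Import Coquelicot.
Open Scope R_scope.

(** The functionals [moment m], pairings with the common eigenvectors
    [(1 - z)^m] of the composition operators [C_phi_t], separate points and turn
    the operators into multipliers: the adjoint of [C_phi_t] multiplies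
    [moment m] by [e^(-t m)], the Cesaro operator [C] by [1 / (m + 1)], hence
    [C^beta] by [(m + 1)^(-beta)]. By Hardy's argument [V = I - C] is a
    contraction, and the binomial series of [(1 - v)^beta] is absolutely
    summable on the closed disc when [Re beta > 0]; so [C^beta = (I - V)^beta]
    is a norm convergent series of polynomials in [C], which gives the first
    claim. For the converse, comparison of multipliers shows
    [(C^(1/n))^n = C]. *)

(** The integral defining $\mathcal{C}^\beta f$ does not show that it stays in [M]: invariance is
    given for $\mathcal{C}$, the resolvent of $A^*$ at 1, and nothing is known at the start about
    the operators $C_{\varphi_t}^*$ on [M]. So $\mathcal{C}^\beta f$ has to be reached as a norm
    limit of polynomials in $\mathcal{C}$ applied to [f]. Holomorphic functional calculus does not
    provide it, because the multipliers $1/(m+1)$ accumulate at $0$, the branch point of $z^\beta$.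
    For the same reason $V$ is no strict contraction, which forces absolute summability of the
    binomial series up to radius 1. The eigenvectors come from $1-\varphi_t(z)=e^{-t}(1-z)$. Moments
    are bounded functionals, hence pass through norm convergent series and through integrals alike.
    They reduce the comparison of the two expressions to scalars: the binomial series at
    $v=1-1/(m+1)\in[0,1)$ on one side, a substitution in the Gamma integral on the other. Being
    finite differences of Taylor coefficients, they make the multipliers a matter of algebra with
    the shift. *)

Notation Rsum := (sum_n (G := R_AbelianMonoid)).
Notation Csum := (sum_n (G := C_AbelianMonoid)).

(** * Finite sums and the Schur test *)

(* Equations between values of [sum_n] are typed by the carrier of a canonical
   structure, which [ring] does not recognise. *)
Ltac cring :=
  match goal with
  | |- @eq _ ?a ?b => first [change (@eq R a b) | change (@eq C a b)]
  end; ring.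

Lemma Rsum_S (u : nat -> R) (n : nat) : Rsum u (S n) = Rsum u n + u (S n) :> R.
Proof. exact (sum_Sn u n). Qed.

Lemma Csum_S (u : nat -> C) (n : nat) :
  Csum u (S n) = (Csum u n + u (S n))%C :> C.
Proof. exact (sum_Sn u n). Qed.

Lemma Rsum_first (u : nat -> R) (n : nat) :
  Rsum u (S n) = u O + Rsum (fun k => u (S k)) n :> R.
Proof.
induction n as [|n IH]; [now rewrite Rsum_S, !sum_O|].
rewrite Rsum_S, IH, Rsum_S; cring.
Qed.

Lemma Csum_first (u : nat -> C) (n : nat) :
  Csum u (S n) = (u O + Csum (fun k => u (S k)) n)%C :> C.
Proof.
induction n as [|n IH]; [now rewrite Csum_S, !sum_O|].
rewrite Csum_S, IH, Csum_S; cring.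
Qed.

Lemma Rsum_plus (u v : nat -> R) (n : nat) :
  Rsum (fun k => u k + v k) n = Rsum u n + Rsum v n.
Proof. exact (sum_n_plus u v n). Qed.

Lemma Rsum_scal (c : R) (u : nat -> R) (n : nat) :
  Rsum (fun k => c * u k) n = c * Rsum u n.
Proof. exact (sum_n_mult_l (K := R_Ring) c u n). Qed.

Lemma Csum_plus (u v : nat -> C) (n : nat) :
  Csum (fun k => u k + v k)%C n = (Csum u n + Csum v n)%C.
Proof. exact (sum_n_plus u v n). Qed.

Lemma Csum_scal (c : C) (u : nat -> C) (n : nat) :
  Csum (fun k => c * u k)%C n = (c * Csum u n)%C.
Proof. exact (sum_n_mult_l (K := C_Ring) c u n). Qed.

Lemma Rsum_le (u v : nat -> R) (n : nat) :
  (forall k, (k <= n)%nat -> u k <= v k) -> Rsum u n <= Rsum v n.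
Proof.
intros H; induction n as [|n IH]; [rewrite !sum_O; auto|].
rewrite !Rsum_S; apply Rplus_le_compat; auto.
Qed.

Lemma Rsum_ge0 (u : nat -> R) (n : nat) :
  (forall k, 0 <= u k) -> 0 <= Rsum u n.
Proof.
intros H; induction n as [|n IH]; [rewrite sum_O; auto|].
rewrite Rsum_S; generalize (H (S n)); lra.
Qed.

Lemma Cmod_Csum (u : nat -> C) (n : nat) :
  Cmod (Csum u n) <= Rsum (fun k => Cmod (u k)) n.
Proof.
induction n as [|n IH]; [rewrite !sum_O; apply Rle_refl|].
rewrite Csum_S, Rsum_S.
apply Rle_trans with (1 := Cmod_triangle _ _); lra.
Qed.

Lemma cauchy_schwarz_sum (u v : nat -> R) (n : nat) :
  Rsum (fun j => u j * v j) n ^ 2 <=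
    Rsum (fun j => u j ^ 2) n * Rsum (fun j => v j ^ 2) n.
Proof.
induction n as [|n IH].
- rewrite !sum_O; apply Req_le; cring.
- rewrite !Rsum_S.
  set (c := Rsum (fun j => u j * v j) n) in *.
  assert (HA : 0 <= Rsum (fun j => u j ^ 2) n)
    by (apply Rsum_ge0; intros; apply pow2_ge_0).
  assert (HB : 0 <= Rsum (fun j => v j ^ 2) n)
    by (apply Rsum_ge0; intros; apply pow2_ge_0).
  set (A := Rsum (fun j => u j ^ 2) n) in *.
  set (B := Rsum (fun j => v j ^ 2) n) in *.
  set (x := u (S n)); set (y := v (S n)).
  (* The cross term: [c ^ 2 <= A * B] and the arithmetic-geometric mean inequality. Comparing
     squares avoids roots of [A] and [B]. *)
  assert (H : 2 * (c * (x * y)) <= A * y ^ 2 + B * x ^ 2).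
  { apply Rnot_lt_le; intros Hlt.
    assert (0 <= A * y ^ 2) by (apply Rmult_le_pos; auto using pow2_ge_0).
    assert (0 <= B * x ^ 2) by (apply Rmult_le_pos; auto using pow2_ge_0).
    assert (H1 : (A * y ^ 2 + B * x ^ 2) ^ 2 < (2 * (c * (x * y))) ^ 2) by nra.
    assert (H2 : c ^ 2 * (x * y) ^ 2 <= A * B * (x * y) ^ 2)
      by (apply Rmult_le_compat_r; auto using pow2_ge_0).
    generalize (pow2_ge_0 (A * y ^ 2 - B * x ^ 2)); nra. }
  apply Rle_trans with (c ^ 2 + 2 * (c * (x * y)) + (x * y) ^ 2);
    [apply Req_le; cring|].
  apply Rle_trans with (A * B + (A * y ^ 2 + B * x ^ 2) + (x * y) ^ 2);
    [lra|apply Req_le; cring].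
Qed.

(** Split the weight as $k_j y_j = \sqrt{k_j}\cdot\sqrt{k_j}\,y_j$. *)
Lemma weighted_cauchy_schwarz (k y : nat -> R) (n : nat) :
  (forall j, 0 <= k j) ->
  Rsum (fun j => k j * y j) n ^ 2 <=
    Rsum k n * Rsum (fun j => k j * y j ^ 2) n.
Proof.
intros Hk.
generalize (cauchy_schwarz_sum (fun j => sqrt (k j))
  (fun j => sqrt (k j) * y j) n).
rewrite (sum_n_ext _ (fun j => k j * y j)),
  (sum_n_ext (fun j => sqrt (k j) ^ 2) k),
  (sum_n_ext (fun j => (sqrt (k j) * y j) ^ 2) (fun j => k j * y j ^ 2)).
- auto.
- intros j; rewrite Rpow_mult_distr, pow2_sqrt; auto.
- intros j; apply pow2_sqrt; auto.
- intros j; rewrite <- (sqrt_sqrt (k j)) at 3 by auto; cring.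
Qed.

(** Row sums enter through Cauchy-Schwarz with the weight [K i], column sums after exchanging the
    two summations. Finite sections keep convergence out of the argument. *)
Lemma schur_test (K : nat -> nat -> R) (x : nat -> C) (A B : R) (I J : nat) :
  0 <= A -> (forall i j, 0 <= K i j) ->
  (forall i, Rsum (K i) J <= A) ->
  (forall j, Rsum (fun i => K i j) I <= B) ->
  Rsum (fun i => Cmod (Csum (fun j => RtoC (K i j) * x j)%C J) ^ 2) I
    <= A * B * Rsum (fun j => Cmod (x j) ^ 2) J.
Proof.
intros HA HK Hr Hc.
apply Rle_trans with
  (Rsum (fun i => A * Rsum (fun j => K i j * Cmod (x j) ^ 2) J) I).
- apply Rsum_le; intros i _.
  apply Rle_trans with (Rsum (fun j => K i j * Cmod (x j)) J ^ 2).
  + apply pow_incr; split; [apply Cmod_ge_0|].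
    apply Rle_trans with (1 := Cmod_Csum _ _).
    apply Rsum_le; intros j _.
    rewrite Cmod_mult, Cmod_R, Rabs_pos_eq by auto; apply Rle_refl.
  + apply Rle_trans with (1 := weighted_cauchy_schwarz (K i) _ J (HK i)).
    apply Rmult_le_compat_r; auto.
    apply Rsum_ge0; intros j; apply Rmult_le_pos; auto using pow2_ge_0.
- rewrite Rsum_scal, (sum_n_switch (G := R_AbelianMonoid)), Rmult_assoc.
  apply Rmult_le_compat_l; auto.
  rewrite <- Rsum_scal; apply Rsum_le; intros j _.
  rewrite (sum_n_ext _ (fun i => Cmod (x j) ^ 2 * K i j)) by (intros; cring).
  rewrite Rsum_scal, Rmult_comm.
  apply Rmult_le_compat_r; auto using pow2_ge_0.
Qed.

(** * Bernstein kernels and moments *)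

(** [bern s k j] is the Bernstein weight [binom k j * s^j * (1-s)^(k-j)], that
    is, the coefficient of [z^j] in [(s z + 1 - s)^k]. *)
Fixpoint bern (s : R) (k j : nat) : R :=
  match k, j with
  | O, O => 1
  | O, S _ => 0
  | S k, O => (1 - s) * bern s k O
  | S k, S j => s * bern s k j + (1 - s) * bern s k (S j)
  end.

Lemma bern_ge0 (s : R) (k j : nat) : 0 <= s <= 1 -> 0 <= bern s k j.
Proof.
intros Hs; revert j; induction k as [|k IH]; intros [|j]; simpl; try lra.
- generalize (IH O); nra.
- generalize (IH j) (IH (S j)); nra.
Qed.

Lemma bern_gt (s : R) (k j : nat) : (k < j)%nat -> bern s k j = 0.
Proof.
revert j; induction k as [|k IH]; intros [|j] H; simpl; try lia; try lra.
rewrite !IH by lia; cring.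
Qed.

Lemma bern_row (s : R) (k N : nat) : 0 <= s <= 1 -> Rsum (bern s k) N <= 1.
Proof.
intros Hs; revert N; induction k as [|k IH]; intros N.
- apply Req_le; induction N as [|N HN]; [now rewrite sum_O|].
  rewrite Rsum_S, HN; simpl; cring.
- destruct N as [|N].
  + rewrite sum_O; simpl; generalize (IH O) (bern_ge0 s k O Hs).
    rewrite sum_O; nra.
  + rewrite Rsum_first; simpl bern.
    rewrite (Rsum_plus (fun j => s * bern s k j)
      (fun j => (1 - s) * bern s k (S j))), !Rsum_scal.
    generalize (IH N) (IH (S N)); rewrite (Rsum_first _ N); nra.
Qed.

(** The whole column sums to exactly $1/s$ (negative binomial distribution). In the induction on
    [j], the recursion of [bern] bounds [s] times the sum of column [S j] by the same quantity for
    column [j]. This $1/s$ is the source of the norm $e^{t/2}$ of $C_{\varphi_t}$. *)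
Lemma bern_col (s : R) (j N : nat) : 0 < s <= 1 ->
  Rsum (fun k => bern s k j) N <= / s.
Proof.
intros Hs.
assert (H : s * Rsum (fun k => bern s k j) N <= 1).
2: { apply Rmult_le_reg_l with s; [lra|]; rewrite Rinv_r by lra; exact H. }
revert N; induction j as [|j IH]; intros N.
- assert (H : s * Rsum (fun k => bern s k O) N = 1 - (1 - s) * bern s N O).
  { induction N as [|N IH]; [rewrite sum_O; simpl; cring|].
    rewrite Rsum_S, Rmult_plus_distr_l, IH; simpl; cring. }
  rewrite H.
  generalize (bern_ge0 s N O); nra.
- apply Rle_trans with (2 := IH N).
  assert (H : Rsum (fun k => bern s k (S j)) (S N) =
    s * Rsum (fun k => bern s k j) N +
    (1 - s) * Rsum (fun k => bern s k (S j)) N).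
  { rewrite Rsum_first; simpl bern.
    rewrite (Rsum_plus (fun k => s * bern s k j)
      (fun k => (1 - s) * bern s k (S j))), !Rsum_scal; cring. }
  rewrite Rsum_S in H.
  generalize (bern_ge0 s (S N) (S j)); lra.
Qed.

(** In the closed form, $s^k\le 1$ and $(1-s)^{n-k}\le(1-s_0)^{n-k}$. This gives each column a
    summable majorant that is uniform in $s\ge s_0$. *)
Lemma bern_domin (s0 s : R) (n k : nat) : 0 < s0 <= s -> s <= 1 ->
  bern s n k <= bern s0 n k / s0 ^ k.
Proof.
intros H0 H1; revert k; induction n as [|n IH]; intros [|k]; simpl bern.
- simpl; lra.
- unfold Rdiv; rewrite Rmult_0_l; lra.
- generalize (IH O) (bern_ge0 s n O); simpl; rewrite Rdiv_1_r.
  unfold Rdiv; rewrite Rinv_1, Rmult_1_r; nra.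
- generalize (bern_ge0 s n k) (bern_ge0 s n (S k)) (IH k) (IH (S k)).
  intros Hk HSk HIk HISk.
  assert (Hp : 0 < s0 ^ k) by (apply pow_lt; lra).
  replace ((s0 * bern s0 n k + (1 - s0) * bern s0 n (S k)) / s0 ^ S k) with
    (bern s0 n k / s0 ^ k + (1 - s0) * (bern s0 n (S k) / s0 ^ S k))
    by (simpl; field; lra).
  apply Rplus_le_compat; [nra|].
  apply Rle_trans with ((1 - s0) * bern s n (S k)); [nra|].
  apply Rmult_le_compat_l; lra.
Qed.

Lemma bern_continuous (s : R) (k j : nat) :
  continuous (fun s => bern s k j) s.
Proof.
revert j; induction k as [|k IH]; intros [|j]; simpl; try apply continuous_const.
- apply (continuous_mult (K := R_AbsRing) (fun s => 1 - s)); auto.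
  apply (continuous_minus (V := R_NormedModule)).
  + apply continuous_const.
  + apply continuous_id.
- apply (continuous_plus (V := R_NormedModule) (fun s => s * bern s k j)).
  + apply (continuous_mult (K := R_AbsRing) (fun s => s)); auto.
    apply continuous_id.
  + apply (continuous_mult (K := R_AbsRing) (fun s => 1 - s)); auto.
    apply (continuous_minus (V := R_NormedModule)).
    * apply continuous_const.
    * apply continuous_id.
Qed.

(** * Hausdorff means and finite differences *)

Definition shift (w : nat -> C) (n : nat) : C := w (S n).

(** The Euler mean, a Hausdorff matrix. For $s=e^{-t}$ its row [k] lists the Taylor coefficients of
    $\varphi_t^k$, the image of $z^k$ under $C_{\varphi_t}$, so it is the matrix of the adjoint. *)
Definition hausdorff (s : R) (w : nat -> C) (k : nat) : C :=
  Csum (fun j => RtoC (bern s k j) * w j)%C k.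

Lemma sum_n_zero_ge {G : AbelianMonoid} (u : nat -> G) (k N : nat) :
  (k <= N)%nat ->
  (forall j, (k < j)%nat -> u j = zero) -> sum_n u N = sum_n u k.
Proof.
intros HkN Hu; induction N as [|N IH].
- now replace k with O by lia.
- destruct (Nat.eq_dec k (S N)) as [->|Hne]; [reflexivity|].
  rewrite sum_Sn, IH, Hu by lia; apply plus_zero_r.
Qed.

Lemma hausdorff_ge (s : R) (w : nat -> C) (k N : nat) : (k <= N)%nat ->
  Csum (fun j => RtoC (bern s k j) * w j)%C N = hausdorff s w k.
Proof.
intros HkN; apply sum_n_zero_ge; auto.
intros j Hj; rewrite bern_gt by exact Hj; apply Cmult_0_l.
Qed.

Lemma hausdorff_O (s : R) (w : nat -> C) : hausdorff s w 0 = w O.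
Proof. unfold hausdorff; rewrite sum_O; simpl; apply Cmult_1_l. Qed.

(** With $E$ the shift, [hausdorff s w k] is $((1-s)+sE)^k w$ at $0$; one factor is peeled off. *)
Lemma hausdorff_S (s : R) (w : nat -> C) (k : nat) :
  hausdorff s w (S k) =
    (RtoC s * hausdorff s (shift w) k + RtoC (1 - s) * hausdorff s w k)%C.
Proof.
rewrite <- (hausdorff_ge s w k (S k)) by lia; unfold hausdorff.
rewrite !(Csum_first _ k); simpl bern.
rewrite (sum_n_ext _ (fun j => RtoC s * (RtoC (bern s k j) * shift w j) +
  RtoC (1 - s) * (RtoC (bern s k (S j)) * w (S j)))%C).
2: { intros j; unfold shift; rewrite RtoC_plus, !RtoC_mult; cring. }
rewrite (Csum_plus (fun j => RtoC s * (RtoC (bern s k j) * shift w j))%C),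
  !Csum_scal, RtoC_mult; cring.
Qed.

Lemma hausdorff_linear (s : R) (c : C) (v w : nat -> C) (k : nat) :
  hausdorff s (fun n => v n + c * w n)%C k =
    (hausdorff s v k + c * hausdorff s w k)%C.
Proof.
unfold hausdorff; rewrite <- Csum_scal, <- Csum_plus.
apply sum_n_ext; intros j; cring.
Qed.

(** The sequence $z^n$ is an eigenvector of the shift with eigenvalue $z$. The factor [c] in the
    auxiliary statement absorbs that eigenvalue at each step. *)
Lemma hausdorff_pow (s : R) (z : C) (k : nat) :
  hausdorff s (fun n => @pow_n C_Ring z n) k =
    @pow_n C_Ring (RtoC s * z + 1 - RtoC s)%C k.
Proof.
assert (H : forall k c, hausdorff s (fun n => c * @pow_n C_Ring z n)%C k =
  (c * @pow_n C_Ring (RtoC s * z + 1 - RtoC s) k)%C).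
{ clear k; induction k as [|k IH]; intros c.
  - now rewrite hausdorff_O.
  - rewrite hausdorff_S, IH.
    replace (shift (fun n => c * @pow_n C_Ring z n)%C) with
      (fun n => (c * z) * @pow_n C_Ring z n)%C.
    + rewrite IH; simpl; unfold mult; simpl; rewrite RtoC_minus; cring.
    + apply functional_extensionality; intros n; unfold shift; simpl.
      unfold mult; simpl; cring. }
rewrite <- (Cmult_1_l (pow_n _ k)), <- H; f_equal.
apply functional_extensionality; intros n; symmetry; apply Cmult_1_l.
Qed.

Definition diff (w : nat -> C) (n : nat) : C := (w n - w (S n))%C.

(** [(1 - E)^m w 0] for the shift [E]: the pairing of [w] with the
    eigenvector [(1 - z)^m] of the composition operators. *)
Definition moment (m : nat) (w : nat -> C) : C := Nat.iter m diff w O.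

Lemma iter_diff_S (m : nat) (w : nat -> C) (n : nat) :
  Nat.iter (S m) diff w n =
    (Nat.iter m diff w n - Nat.iter m diff w (S n))%C.
Proof. reflexivity. Qed.

Lemma iter_diff_shift (m : nat) (w : nat -> C) :
  Nat.iter m diff (diff w) = diff (Nat.iter m diff w).
Proof. induction m as [|m IH]; [reflexivity|simpl; now rewrite IH]. Qed.

(** This is $1-((1-s)+sE)=s(1-E)$; iterated, it yields the multiplier $s^m$ of [moment m]. *)
Lemma diff_hausdorff (s : R) (w : nat -> C) :
  diff (hausdorff s w) = fun k => (RtoC s * hausdorff s (diff w) k)%C.
Proof.
apply functional_extensionality; intros k; unfold diff at 1.
rewrite hausdorff_S.
replace (diff w) with (fun n => w n + (-1) * shift w n)%C.
- rewrite hausdorff_linear, RtoC_minus; cring.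
- apply functional_extensionality; intros n; unfold diff, shift; cring.
Qed.

Lemma iter_diff_plus (m : nat) (v w : nat -> C) (n : nat) :
  Nat.iter m diff (fun n => v n + w n)%C n =
    (Nat.iter m diff v n + Nat.iter m diff w n)%C.
Proof.
revert n; induction m as [|m IH]; intros n; [reflexivity|].
rewrite !iter_diff_S, !IH; cring.
Qed.

Lemma iter_diff_scal (m : nat) (c : C) (w : nat -> C) (n : nat) :
  Nat.iter m diff (fun n => c * w n)%C n = (c * Nat.iter m diff w n)%C.
Proof.
revert n; induction m as [|m IH]; intros n; [reflexivity|].
rewrite !iter_diff_S, !IH; cring.
Qed.

Lemma moment_hausdorff (m : nat) (s : R) (w : nat -> C) :
  moment m (hausdorff s w) = (RtoC (s ^ m) * moment m w)%C.
Proof.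
unfold moment.
assert (H : forall m w, Nat.iter m diff (hausdorff s w) =
  fun k => (RtoC (s ^ m) * hausdorff s (Nat.iter m diff w) k)%C).
{ clear m w; induction m as [|m IH]; intros w.
  - apply functional_extensionality; intros k; simpl; cring.
  - change (diff (Nat.iter m diff (hausdorff s w)) =
      fun k => (RtoC (s ^ S m) * hausdorff s (diff (Nat.iter m diff w)) k)%C).
    rewrite <- iter_diff_shift, diff_hausdorff.
    apply functional_extensionality; intros k.
    rewrite iter_diff_scal, IH, iter_diff_shift; simpl.
    rewrite RtoC_mult; cring. }
rewrite H, hausdorff_O; reflexivity.
Qed.

(** Since $(1-E)^m w_{n+1}=(1-E)^m w_n-(1-E)^{m+1}w_n$, the differences of all orders at [n]
    determine those at [n + 1]; the induction must carry every [m] at once. *)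
Lemma moment_inj (v w : nat -> C) :
  (forall m, moment m v = moment m w) -> v = w.
Proof.
intros H.
assert (H0 : forall n m, Nat.iter m diff v n = Nat.iter m diff w n).
{ induction n as [|n IH]; intros m; [apply H|].
  generalize (IH (S m)); rewrite !iter_diff_S, IH; intros E.
  replace (Nat.iter m diff v (S n)) with
    (Nat.iter m diff w n - (Nat.iter m diff w n - Nat.iter m diff v (S n)))%C
    by cring.
  rewrite E; cring. }
apply functional_extensionality; intros n; apply (H0 n O).
Qed.

Lemma Cmod_iter_diff (m : nat) (w : nat -> C) (B : R) (n : nat) :
  (forall n, Cmod (w n) <= B) -> Cmod (Nat.iter m diff w n) <= 2 ^ m * B.
Proof.
intros H; revert n; induction m as [|m IH]; intros n.
- simpl; rewrite Rmult_1_l; apply H.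
- rewrite iter_diff_S.
  apply Rle_trans with (1 := Cmod_triangle _ _).
  rewrite Cmod_opp; generalize (IH n) (IH (S n)); simpl; lra.
Qed.

(** * Cesàro means and the generator *)

Definition cesaro (w : nat -> C) (n : nat) : C :=
  (/ RtoC (INR (n + 1)) * Csum w n)%C.

Lemma cesaro_O (w : nat -> C) : cesaro w O = w O.
Proof.
unfold cesaro; rewrite sum_O; simpl.
field; intros E; injection E; lra.
Qed.

Lemma cesaro_S (w : nat -> C) (n : nat) :
  w (S n) = (RtoC (INR n + 2) * cesaro w (S n) - RtoC (INR n + 1) * cesaro w n)%C.
Proof.
unfold cesaro; rewrite Csum_S.
replace (INR (S n + 1)) with (INR n + 2) by (rewrite plus_INR, S_INR; simpl; cring).
replace (INR (n + 1)) with (INR n + 1) by (rewrite plus_INR; simpl; cring).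
assert (H1 : RtoC (INR n + 1) <> 0).
{ intros E; injection E; generalize (pos_INR n); lra. }
assert (H2 : RtoC (INR n + 2) <> 0).
{ intros E; injection E; generalize (pos_INR n); lra. }
field; auto.
Qed.

Definition euler (w : nat -> C) (n : nat) : C :=
  (RtoC (INR n) * (w n - w (pred n)))%C.

Lemma diff_euler (w : nat -> C) :
  diff (euler w) = fun n => (diff w n + euler (diff w) n)%C.
Proof.
apply functional_extensionality; intros n; unfold diff at 1, euler.
rewrite S_INR, RtoC_plus; destruct n as [|n]; unfold diff; simpl pred.
- simpl; cring.
- rewrite S_INR, RtoC_plus; cring.
Qed.

(** By [diff_euler], each difference moved past [euler] adds 1; the remaining [euler] term vanishes
    at index 0. *)
Lemma moment_euler (m : nat) (w : nat -> C) :
  moment m (euler w) = (RtoC (INR m) * moment m w)%C.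
Proof.
assert (H : forall m w, Nat.iter m diff (euler w) = fun n =>
  (euler (Nat.iter m diff w) n + RtoC (INR m) * Nat.iter m diff w n)%C).
{ clear m w; induction m as [|m IH]; intros w.
  - apply functional_extensionality; intros n; simpl; cring.
  - apply functional_extensionality; intros n.
    change (Nat.iter (S m) diff (euler w) n) with
      (diff (Nat.iter m diff (euler w)) n).
    rewrite <- iter_diff_shift, diff_euler.
    rewrite iter_diff_plus, IH, S_INR, RtoC_plus, iter_diff_shift.
    change (Nat.iter (S m) diff w) with (diff (Nat.iter m diff w)); cring. }
unfold moment; rewrite H; unfold euler; simpl; cring.
Qed.

Lemma moment_cesaro (m : nat) (w : nat -> C) :
  moment m w = (RtoC (INR m + 1) * moment m (cesaro w))%C.
Proof.
replace w with (fun n => euler (cesaro w) n + cesaro w n)%C at 1.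
- unfold moment; rewrite iter_diff_plus.
  fold (moment m (euler (cesaro w))); rewrite moment_euler, RtoC_plus.
  unfold moment; cring.
- apply functional_extensionality; intros [|n]; unfold euler.
  + rewrite cesaro_O; simpl; cring.
  + rewrite (cesaro_S w n); simpl pred; rewrite S_INR, !RtoC_plus; cring.
Qed.

(** * Adjoints of the composition operators *)

Definition of_taylor (a : nat -> C) : H2 :=
  epsilon (inhabits H2_zero) (fun f => taylor f = a).

Lemma taylor_of_taylor (a : nat -> C) : sqsum a -> taylor (of_taylor a) = a.
Proof.
intros Ha; unfold of_taylor; apply epsilon_spec; now apply H2_of_taylor_ex.
Qed.

Lemma sqsum_bounded (a : nat -> C) (M : R) :
  (forall N, Rsum (fun n => Cmod (a n) ^ 2) N <= M ^ 2) -> 0 <= M ->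
  sqsum a /\ l2norm a <= M.
Proof.
intros H HM.
destruct (pos_series_bounded _ _ (sqC_ge0 a) H) as [H1 Hn2].
split; [exact H1|].
rewrite <- (sqrt_pow2 M) by exact HM; now apply sqrt_le_1_alt.
Qed.

Lemma Rsum_sq_le_l2norm (a : nat -> C) (N : nat) : sqsum a ->
  Rsum (fun n => Cmod (a n) ^ 2) N <= l2norm a ^ 2.
Proof.
intros Ha; rewrite l2norm_sqr by exact Ha.
now apply pos_series_partial; [apply sqC_ge0|].
Qed.

Lemma hausdorff_l2 (s : R) (a : nat -> C) : 0 < s <= 1 -> sqsum a ->
  sqsum (hausdorff s a) /\ l2norm (hausdorff s a) <= sqrt (/ s) * l2norm a.
Proof.
intros Hs Ha.
assert (Hs' : 0 < / s) by (apply Rinv_0_lt_compat; lra).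
apply sqsum_bounded.
2: { apply Rmult_le_pos; [apply sqrt_pos|apply l2norm_ge0]. }
intros N; rewrite Rpow_mult_distr, pow2_sqrt by lra.
apply Rle_trans with
  (1 * / s * Rsum (fun j => Cmod (a j) ^ 2) N).
(* The matrix is lower triangular, so every inner sum may run to the common bound [N]; the Schur
   test wants a rectangular section. *)
- apply Rle_trans with (Rsum (fun i => Cmod
    (Csum (fun j => RtoC (bern s i j) * a j)%C N) ^ 2) N).
  + apply Rsum_le; intros k Hk; rewrite hausdorff_ge by exact Hk.
    apply Rle_refl.
  + apply schur_test; [lra| | |].
    * intros i j; apply bern_ge0; lra.
    * intros i; apply bern_row; lra.
    * intros j; now apply bern_col.
- rewrite Rmult_1_l; apply Rmult_le_compat_l; [lra|].
  now apply Rsum_sq_le_l2norm.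
Qed.

Definition hausdorff_op (s : R) (f : H2) : H2 :=
  of_taylor (hausdorff s (taylor f)).

Lemma taylor_hausdorff_op (s : R) (f : H2) : 0 < s <= 1 ->
  taylor (hausdorff_op s f) = hausdorff s (taylor f).
Proof.
intros Hs; apply taylor_of_taylor.
now apply hausdorff_l2; [|apply taylor_sqsum].
Qed.

Lemma norm_hausdorff_op (s : R) (f : H2) : 0 < s <= 1 ->
  H2_norm (hausdorff_op s f) <= sqrt (/ s) * H2_norm f.
Proof.
intros Hs; unfold H2_norm; rewrite taylor_hausdorff_op by exact Hs.
now apply hausdorff_l2; [|apply taylor_sqsum].
Qed.

Lemma hausdorff_op_minus (s : R) (f g : H2) : 0 < s <= 1 ->
  hausdorff_op s (minus f g) = minus (hausdorff_op s f) (hausdorff_op s g).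
Proof.
intros Hs; apply taylor_inj.
rewrite taylor_minus, !taylor_hausdorff_op, taylor_minus by exact Hs.
apply functional_extensionality; intros n; unfold Cminus.
replace (fun n => taylor f n + - taylor g n)%C with
  (fun n => taylor f n + (-1) * taylor g n)%C.
- rewrite hausdorff_linear; ring.
- apply functional_extensionality; intros k; ring.
Qed.

(** * Inner products and bounded functionals *)

Lemma l2_mult (a b : nat -> C) : sqsum a -> sqsum b ->
  ex_series (fun n => Cmod (a n) * Cmod (b n)) /\
  Series (fun n => Cmod (a n) * Cmod (b n)) <= l2norm a * l2norm b.
Proof.
intros Ha Hb; apply pos_series_bounded.
- intros n; apply Rmult_le_pos; apply Cmod_ge_0.
- intros N; apply Rsqr_incr_0_var.
  2: { apply Rmult_le_pos; apply l2norm_ge0. }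
  rewrite !Rsqr_pow2.
  apply Rle_trans with (1 := cauchy_schwarz_sum (fun n => Cmod (a n))
    (fun n => Cmod (b n)) N).
  rewrite Rpow_mult_distr; apply Rmult_le_compat.
  + apply Rsum_ge0; intros; apply pow2_ge_0.
  + apply Rsum_ge0; intros; apply pow2_ge_0.
  + now apply Rsum_sq_le_l2norm.
  + now apply Rsum_sq_le_l2norm.
Qed.

Lemma is_series_CSeries (u : nat -> C) (l : C) :
  is_series (K := C_AbsRing) (V := C_NormedModule) u l -> CSeries u = l.
Proof.
intros H; rewrite (surjective_pairing l); unfold CSeries; f_equal.
- exact (is_series_unique _ _ (is_series_Cpart true u l H)).
- exact (is_series_unique _ _ (is_series_Cpart false u l H)).
Qed.

Lemma is_series_finite {K : AbsRing} {V : NormedModule K} (u : nat -> V)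
  (N : nat) : (forall n, (N < n)%nat -> u n = zero) ->
  is_series u (sum_n u N).
Proof.
intros Hu; unfold is_series.
apply filterlim_ext_loc with (fun _ : nat => sum_n u N);
  [|apply filterlim_const].
exists N; intros n Hn; symmetry; now apply sum_n_zero_ge.
Qed.

Lemma inner_is_series (f g : H2) :
  is_series (K := C_AbsRing) (V := C_NormedModule)
    (fun n => taylor f n * Cconj (taylor g n))%C (H2_inner f g) /\
  Cmod (H2_inner f g) <= H2_norm f * H2_norm g.
Proof.
destruct (l2_mult _ _ (taylor_sqsum f) (taylor_sqsum g)) as [H1 Hn2].
assert (Hle : forall n, Cmod (taylor f n * Cconj (taylor g n))%C
  <= Cmod (taylor f n) * Cmod (taylor g n)).
{ intros n; rewrite Cmod_mult, Cmod_conj; apply Rle_refl. }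
destruct (ex_series_le (K := C_AbsRing) (V := C_CompleteNormedModule)
  _ _ Hle H1) as [l Hl].
assert (E : H2_inner f g = l) by now apply is_series_CSeries.
rewrite E; split; [exact Hl|].
apply Rle_trans with (2 := Hn2).
assert (Hl' : is_lim_seq (fun N => Cmod (Csum
  (fun n => taylor f n * Cconj (taylor g n))%C N)) (Cmod l)).
{ apply (filterlim_comp _ _ _ _ (@norm _ C_NormedModule) _ _ _ Hl).
  apply (filterlim_norm (V := C_NormedModule)). }
apply (is_lim_seq_le _ (fun _ => Series
  (fun n => Cmod (taylor f n) * Cmod (taylor g n))) (Cmod l)
  (Series (fun n => Cmod (taylor f n) * Cmod (taylor g n)))) with (2 := Hl').
- intros N; apply Rle_trans with (1 := Cmod_Csum _ _).
  apply Rle_trans with (Rsum (fun n => Cmod (taylor f n) * Cmod (taylor g n)) N).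
  + apply Rsum_le; auto.
  + apply pos_series_partial; auto.
    intros n; apply Rmult_le_pos; apply Cmod_ge_0.
- apply is_lim_seq_const.
Qed.

Notation linear_functional l :=
  (is_linear (K := C_AbsRing) (U := H2_NormedModule) (V := C_NormedModule) l).

Lemma inner_linear (g : H2) : linear_functional (fun f => H2_inner f g).
Proof.
apply Build_is_linear.
- intros x y; apply is_series_CSeries.
  generalize (is_series_plus _ _ _ _
    (proj1 (inner_is_series x g)) (proj1 (inner_is_series y g))).
  apply is_series_ext; intros n.
  change (plus x y) with (H2_plus x y); rewrite taylor_plus.
  change (taylor x n * Cconj (taylor g n) + taylor y n * Cconj (taylor g n) =
    (taylor x n + taylor y n) * Cconj (taylor g n))%C; ring.
- intros c x; apply is_series_CSeries.
  generalize (is_series_scal (K := C_AbsRing) (V := C_NormedModule) c _ _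
    (proj1 (inner_is_series x g))).
  apply is_series_ext; intros n.
  change (scal c x) with (H2_scal c x); rewrite taylor_scal.
  change (c * (taylor x n * Cconj (taylor g n)) =
    (c * taylor x n) * Cconj (taylor g n))%C; ring.
- exists (H2_norm g + 1); split.
  + generalize (l2norm_ge0 (taylor g)); unfold H2_norm; lra.
  + intros x; change (Cmod (H2_inner x g) <= (H2_norm g + 1) * H2_norm x).
    apply Rle_trans with (1 := proj2 (inner_is_series x g)).
    generalize (l2norm_ge0 (taylor x)); unfold H2_norm; lra.
Qed.

Lemma moment_linear (m : nat) : linear_functional (fun f => moment m (taylor f)).
Proof.
apply Build_is_linear.
- intros x y; change (plus x y) with (H2_plus x y); rewrite taylor_plus.
  apply iter_diff_plus.
- intros c x; change (scal c x) with (H2_scal c x); rewrite taylor_scal.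
  apply iter_diff_scal.
- exists (2 ^ m); split; [apply pow_lt; lra|].
  intros x; apply Cmod_iter_diff.
  intros n; apply l2norm_term, taylor_sqsum.
Qed.

Lemma linear_sum_n {K : AbsRing} {U V : NormedModule K} (l : U -> V)
  (a : nat -> U) (n : nat) : is_linear l ->
  l (sum_n a n) = sum_n (fun k => l (a k)) n.
Proof.
intros Hl; induction n as [|n IH]; [now rewrite !sum_O|].
now rewrite !sum_Sn, (linear_plus l Hl), IH.
Qed.

Lemma linear_is_series {K : AbsRing} {U V : NormedModule K} (l : U -> V)
  (a : nat -> U) (x : U) : is_linear l ->
  is_series a x -> is_series (fun k => l (a k)) (l x).
Proof.
intros Hl Ha; unfold is_series.
apply filterlim_ext with (fun n => l (sum_n a n)).
- intros n; now apply linear_sum_n.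
- apply filterlim_comp with (1 := Ha); now apply linear_cont.
Qed.

Lemma is_series_C_unique (u : nat -> C) (x y : C) :
  is_series (K := C_AbsRing) (V := C_NormedModule) u x ->
  is_series (K := C_AbsRing) (V := C_NormedModule) u y -> x = y.
Proof.
intros Hx Hy; rewrite <- (is_series_CSeries u x Hx).
now apply is_series_CSeries.
Qed.

(** Evaluation at [z] is the pairing with the Szegő kernel, whose coefficients $\bar z^n$ are square
    summable in the disc. *)
Lemma eval_linear (z : C) : Cmod z < 1 -> linear_functional (fun f : H2 => f z).
Proof.
intros Hz.
assert (Hk : sqsum (fun n => Cconj (@pow_n C_Ring z n))).
{ unfold sqsum; apply ex_series_ext with (fun n => (Cmod z ^ 2) ^ n).
  - intros n; rewrite Cmod_conj, Cmod_pow_n, <- !pow_mult, Nat.mul_comm.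
    reflexivity.
  - apply ex_series_geom; rewrite Rabs_pos_eq by apply pow2_ge_0.
    generalize (Cmod_ge_0 z); nra. }
refine (is_linear_ext _ _ _
  (inner_linear (of_taylor (fun n => Cconj (@pow_n C_Ring z n))))).
intros f; apply is_series_CSeries.
generalize (taylor_pseries f z Hz); apply is_series_ext; intros n.
rewrite taylor_of_taylor by exact Hk; rewrite Cconj_conj; apply Cmult_comm.
Qed.

(** * Composition operators expanded in powers of the symbol *)

Lemma sqsum_finite (a : nat -> C) (N : nat) :
  (forall n, (N < n)%nat -> a n = RtoC 0) -> sqsum a.
Proof.
intros Ha; eexists; apply (is_series_finite _ N).
intros n Hn; rewrite Ha, Cmod_0 by exact Hn; apply pow_i; lia.
Qed.

Definition phi_pow (s : R) (k : nat) : H2 :=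
  of_taylor (fun j => RtoC (bern s k j)).

Lemma taylor_phi_pow (s : R) (k : nat) :
  taylor (phi_pow s k) = fun j => RtoC (bern s k j).
Proof.
apply taylor_of_taylor, (sqsum_finite _ k).
intros n Hn; now rewrite bern_gt.
Qed.

Lemma phi_pow_eval (s : R) (k : nat) (z : C) : Cmod z < 1 ->
  phi_pow s k z = @pow_n C_Ring (RtoC s * z + 1 - RtoC s)%C k.
Proof.
intros Hz; apply (is_series_C_unique _ _ _ (taylor_pseries (phi_pow s k) z Hz)).
rewrite taylor_phi_pow, <- hausdorff_pow; unfold hausdorff.
rewrite (sum_n_ext _ (fun j => @pow_n C_Ring z j * RtoC (bern s k j))%C)
  by (intros; apply Cmult_comm).
apply (is_series_finite (K := C_AbsRing) (V := C_NormedModule)).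
intros n Hn; rewrite bern_gt by exact Hn; apply Cmult_0_r.
Qed.

Lemma phi_pow_inner (s : R) (k : nat) (f : H2) :
  H2_inner (phi_pow s k) f = Cconj (hausdorff s (taylor f) k).
Proof.
apply is_series_CSeries; rewrite taylor_phi_pow.
replace (Cconj (hausdorff s (taylor f) k)) with
  (Csum (fun j => RtoC (bern s k j) * Cconj (taylor f j))%C k).
- apply (is_series_finite (K := C_AbsRing) (V := C_NormedModule)).
  intros n Hn; rewrite bern_gt by exact Hn; apply Cmult_0_l.
(* Only the upper summation limits vary in the induction; the row index of the weights stays [k]. *)
- unfold hausdorff; generalize k at 2 4; intros N; induction N as [|N IH].
  + rewrite !sum_O, Cmult_conj; f_equal.
    unfold Cconj, RtoC; simpl; f_equal; ring.
  + rewrite !Csum_S, IH, Cplus_conj, Cmult_conj; f_equal; f_equal.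
    unfold Cconj, RtoC; simpl; f_equal; ring.
Qed.

Lemma taylor_sum_n (u : nat -> H2) (N j : nat) :
  taylor (sum_n u N) j = Csum (fun k => taylor (u k) j) N.
Proof.
induction N as [|N IH]; [now rewrite !sum_O|].
rewrite sum_Sn, Csum_S, <- IH.
change (plus (sum_n u N) (u (S N))) with (H2_plus (sum_n u N) (u (S N))).
now rewrite taylor_plus.
Qed.

(** The Schur test for the transposed matrix, the bounds $1$ and $1/s$ exchanging roles: on
    polynomials this is $\|C_{\varphi_t}\|^2\le e^t$. *)
Lemma phi_pow_sum_norm (s : R) (c : nat -> C) (N : nat) : 0 < s <= 1 ->
  H2_norm (sum_n (fun k => scal (c k) (phi_pow s k)) N) ^ 2
    <= / s * Rsum (fun k => Cmod (c k) ^ 2) N.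
Proof.
intros Hs.
assert (Hs' : 0 < / s) by (apply Rinv_0_lt_compat; lra).
set (M := / s * Rsum (fun k => Cmod (c k) ^ 2) N).
assert (HM : 0 <= M).
{ apply Rmult_le_pos; [lra|apply Rsum_ge0; intros; apply sqC_ge0]. }
rewrite <- (pow2_sqrt M) by exact HM.
apply pow_incr; split; [apply l2norm_ge0|].
apply sqsum_bounded; [|apply sqrt_pos].
intros J; rewrite pow2_sqrt by exact HM.
rewrite (sum_n_ext _ (fun i => Cmod (Csum
  (fun k => RtoC (bern s k i) * c k)%C N) ^ 2)).
- unfold M; rewrite <- (Rmult_1_r (/ s)).
  apply (schur_test (fun i k => bern s k i)); [lra| | |].
  + intros i j; apply bern_ge0; lra.
  + intros i; now apply bern_col.
  + intros j; apply bern_row; lra.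
- intros i; rewrite taylor_sum_n; f_equal; f_equal; apply sum_n_ext; intros k.
  change (scal (c k) (phi_pow s k)) with (H2_scal (c k) (phi_pow s k)).
  rewrite taylor_scal, taylor_phi_pow; apply Cmult_comm.
Qed.

(** Turns a Cauchy block into a full sum with zeroed initial coefficients, to which
    [phi_pow_sum_norm] applies. *)
Lemma sum_n_m_truncate {G : AbelianMonoid} (a : nat -> G) (n m : nat) :
  sum_n_m a n m = sum_n (fun k => if (k <? n)%nat then zero else a k) m.
Proof.
induction m as [|m IH].
- rewrite sum_O; destruct n as [|n]; [apply sum_n_n|].
  apply sum_n_m_zero; lia.
- rewrite sum_Sn, <- IH; destruct (Nat.ltb_spec (S m) n) as [H|H].
  + rewrite !sum_n_m_zero by lia; now rewrite plus_zero_r.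
  + now apply sum_n_Sm.
Qed.

Lemma phi_pow_ex_series (s : R) (g : H2) : 0 < s <= 1 ->
  exists h : H2, is_series (K := C_AbsRing) (V := H2_NormedModule)
    (fun k => scal (taylor g k) (phi_pow s k)) h.
Proof.
intros Hs.
apply (ex_series_Cauchy (K := C_AbsRing) (V := H2_CompleteNormedModule)).
intros e.
assert (He : 0 < e ^ 2 * s) by (apply Rmult_lt_0_compat; [apply pow_lt, cond_pos|lra]).
destruct (Cauchy_ex_series (K := R_AbsRing) (V := R_CompleteNormedModule)
  _ (taylor_sqsum g) (mkposreal _ He)) as [N HN].
exists N; intros n m Hn Hm; specialize (HN n m Hn Hm); simpl in HN.
set (c := fun k => if (k <? n)%nat then RtoC 0 else taylor g k).
assert (E1 : sum_n_m (G := H2_AbelianMonoid)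
  (fun k => scal (taylor g k) (phi_pow s k)) n m
  = sum_n (fun k => scal (c k) (phi_pow s k)) m).
{ rewrite sum_n_m_truncate; apply sum_n_ext; intros k; unfold c.
  destruct (k <? n)%nat; [|reflexivity].
  symmetry; apply (scal_zero_l (phi_pow s k : H2_ModuleSpace)). }
assert (E2 : sum_n_m (G := R_AbelianMonoid) (fun k => Cmod (taylor g k) ^ 2) n m
  = Rsum (fun k => Cmod (c k) ^ 2) m).
{ rewrite sum_n_m_truncate; apply sum_n_ext; intros k; unfold c.
  destruct (k <? n)%nat; [|reflexivity].
  rewrite Cmod_0; symmetry; apply pow_i; lia. }
change (H2_norm (sum_n_m (G := H2_AbelianMonoid)
  (fun k => scal (taylor g k) (phi_pow s k)) n m) < e).
change (Rabs (sum_n_m (G := R_AbelianMonoid)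
  (fun k => Cmod (taylor g k) ^ 2) n m) < e ^ 2 * s) in HN.
rewrite E1; rewrite E2 in HN.
apply Rle_lt_trans with (1 := Rle_abs _) in HN.
apply Rsqr_incrst_0; [|apply l2norm_ge0|apply Rlt_le, cond_pos].
rewrite !Rsqr_pow2.
apply Rle_lt_trans with (1 := phi_pow_sum_norm s c m Hs).
apply Rmult_lt_reg_l with s; [lra|].
rewrite <- Rmult_assoc, Rinv_r, Rmult_1_l by lra; lra.
Qed.

Lemma phi_disc (s : R) (z : C) : 0 < s <= 1 -> Cmod z < 1 ->
  Cmod (RtoC s * z + 1 - RtoC s)%C < 1.
Proof.
intros Hs Hz.
replace (RtoC s * z + 1 - RtoC s)%C with (RtoC s * z + RtoC (1 - s))%C
  by (rewrite RtoC_minus; ring).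
apply Rle_lt_trans with (1 := Cmod_triangle _ _).
rewrite Cmod_mult, !Cmod_R, !Rabs_pos_eq by lra; nra.
Qed.

Lemma exp_opp_range (t : R) : 0 <= t -> 0 < exp (- t) <= 1.
Proof.
intros Ht; split; [apply exp_pos|]; rewrite <- exp_0.
destruct (Req_dec t 0) as [->|Hne]; [rewrite Ropp_0; lra|].
apply Rlt_le, exp_increasing; lra.
Qed.

(** As [comp_op] is given by [iota], the composite must be exhibited in [H2]. The sum of $\sum_k
    g_k\varphi_t^k$ exists in norm, and continuity of evaluation identifies it as
    $g\circ\varphi_t$. *)
Lemma comp_op_is_series (t : R) (g : H2) : 0 <= t ->
  is_series (K := C_AbsRing) (V := H2_NormedModule)
    (fun k => scal (taylor g k) (phi_pow (exp (- t)) k)) (comp_op (phi t) g).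
Proof.
intros Ht.
assert (Hs := exp_opp_range t Ht).
destruct (phi_pow_ex_series _ g Hs) as [h Hh].
assert (Hev : forall z, Cmod z < 1 -> h z = g (phi t z)).
{ intros z Hz.
  generalize (linear_is_series _ _ _ (eval_linear z Hz) Hh); intros H1.
  apply (is_series_C_unique _ _ _ H1).
  generalize (taylor_pseries g (phi t z) (phi_disc _ z Hs Hz)).
  apply is_series_ext; intros n; simpl.
  rewrite phi_pow_eval by exact Hz; apply Cmult_comm. }
replace (comp_op (phi t) g) with h; [exact Hh|].
symmetry; unfold comp_op.
apply (iota_unique (V := H2_CompleteNormedModule)); [|exact Hev].
intros y Hy; apply H2_ext; intros z Hz; now rewrite Hy, Hev.
Qed.

(** The functional [H2_inner _ f] is applied termwise to $\sum_k g_k\varphi_t^k$, and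
    $\langle\varphi_t^k,f\rangle$ is the conjugate of the mean of index [k]. *)
Lemma adjoint_comp_op (t : R) (f : H2) : 0 <= t ->
  adjoint (comp_op (phi t)) f = hausdorff_op (exp (- t)) f.
Proof.
intros Ht.
assert (Hs := exp_opp_range t Ht).
assert (Had : forall g,
  H2_inner (comp_op (phi t) g) f = H2_inner g (hausdorff_op (exp (- t)) f)).
{ intros g.
  generalize (linear_is_series _ _ _ (inner_linear f)
    (comp_op_is_series t g Ht)); intros H.
  symmetry; apply is_series_CSeries; revert H.
  apply is_series_ext; intros n.
  rewrite taylor_hausdorff_op, <- phi_pow_inner by exact Hs.
  apply (linear_scal _ (inner_linear f)). }
(* Uniqueness of the adjoint vector: pairing with $z^n$ recovers the coefficient of index [n]. *)
apply (iota_unique (V := H2_CompleteNormedModule)); [|exact Had].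
intros y Hy; apply taylor_inj, functional_extensionality; intros n.
assert (Hd : forall k, (n < k)%nat ->
  (if (k =? n)%nat then RtoC 1 else RtoC 0) = RtoC 0).
{ intros k Hk; destruct (Nat.eqb_spec k n); [lia|reflexivity]. }
assert (He : forall h : H2, H2_inner (of_taylor (fun k =>
  if (k =? n)%nat then RtoC 1 else RtoC 0)) h = Cconj (taylor h n)).
{ intros h; apply is_series_CSeries.
  rewrite taylor_of_taylor by exact (sqsum_finite _ n Hd).
  replace (Cconj (taylor h n)) with (Csum (fun k =>
    (if (k =? n)%nat then RtoC 1 else RtoC 0) * Cconj (taylor h k))%C n).
  - apply (is_series_finite (K := C_AbsRing) (V := C_NormedModule)).
    intros k Hk; rewrite Hd by exact Hk; apply Cmult_0_l.
  - destruct n as [|n]; [rewrite sum_O; simpl; apply Cmult_1_l|].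
    rewrite Csum_S, Nat.eqb_refl, Cmult_1_l.
    rewrite (sum_n_ext_loc _ (fun _ => RtoC 0)).
    + replace (sum_n (G := C_AbelianMonoid) (fun _ => RtoC 0) n) with (RtoC 0).
      * apply Cplus_0_l.
      * symmetry; apply (sum_n_m_const_zero (G := C_AbelianMonoid)).
    + intros k Hk; destruct (Nat.eqb_spec k (S n)); [lia|apply Cmult_0_l]. }
rewrite <- (Cconj_conj (taylor y n)), <- He, <- Hy, Had, He.
apply Cconj_conj.
Qed.

(** * Hardy's contraction and its binomial series *)

Lemma Cmod_sq (z : C) : Cmod z ^ 2 = fst z ^ 2 + snd z ^ 2.
Proof.
unfold Cmod; apply pow2_sqrt.
generalize (pow2_ge_0 (fst z)) (pow2_ge_0 (snd z)); lra.
Qed.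

(* Hardy's computation: substituting
   [w (n+1) = (n+2) b (n+1) - (n+1) b n] for [b = cesaro w] makes the
   difference of the two sides telescope. *)
Lemma cesaro_hardy (w : nat -> C) (N : nat) :
  Rsum (fun n => Cmod (w n - cesaro w n)%C ^ 2) N +
    (INR N + 1) * Cmod (cesaro w N) ^ 2
    <= Rsum (fun n => Cmod (w n) ^ 2) N.
Proof.
induction N as [|N IH].
- rewrite !sum_O, cesaro_O.
  replace (w O - w O)%C with (RtoC 0) by ring.
  rewrite Cmod_0; simpl; lra.
- rewrite !Rsum_S, (cesaro_S w N), S_INR.
  set (x := cesaro w N) in *; set (y := cesaro w (S N)).
  assert (H : Cmod (RtoC (INR N + 2) * y - RtoC (INR N + 1) * x - y)%C ^ 2
    + (INR N + 1 + 1) * Cmod y ^ 2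
    <= Cmod (RtoC (INR N + 2) * y - RtoC (INR N + 1) * x)%C ^ 2
       + (INR N + 1) * Cmod x ^ 2).
  { rewrite !Cmod_sq; destruct x as [x1 x2], y as [y1 y2]; simpl.
    generalize (pos_INR N); intros Hp.
    assert (H1 : 0 <= (INR N + 1) * ((y1 - x1) ^ 2 + (y2 - x2) ^ 2)).
    { apply Rmult_le_pos; [lra|].
      generalize (pow2_ge_0 (y1 - x1)) (pow2_ge_0 (y2 - x2)); lra. }
    apply Rminus_le_0; apply Rle_trans with (1 := H1); apply Req_le; ring. }
  lra.
Qed.

Lemma minus_cesaro_l2 (w : nat -> C) : sqsum w ->
  sqsum (fun n => w n - cesaro w n)%C /\
  l2norm (fun n => w n - cesaro w n)%C <= l2norm w.
Proof.
intros Hw; apply sqsum_bounded; [|apply l2norm_ge0].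
intros N; apply Rle_trans with (2 := Rsum_sq_le_l2norm w N Hw).
generalize (cesaro_hardy w N) (pos_INR N) (sqC_ge0 (cesaro w) N); nra.
Qed.

(** Boundedness of $V$ comes first, and $\mathcal{C}=I-V$ inherits it. *)
Lemma cesaro_sqsum (w : nat -> C) : sqsum w -> sqsum (cesaro w).
Proof.
intros Hw.
generalize (sqsum_plus _ _ Hw
  (sqsum_scal (-1) _ (proj1 (minus_cesaro_l2 w Hw)))).
unfold sqsum; apply ex_series_ext; intros n; f_equal; f_equal; ring.
Qed.

Lemma taylor_Cesaro (f : H2) : taylor (Cesaro_op f) = cesaro (taylor f).
Proof.
assert (Hs := cesaro_sqsum _ (taylor_sqsum f)).
destruct (H2_of_taylor_ex _ Hs) as [g Hg].
rewrite <- Hg; f_equal; unfold Cesaro_op.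
apply (iota_unique (V := H2_CompleteNormedModule)).
- intros y Hy; apply taylor_inj; rewrite Hg.
  now apply taylor_unique.
- intros z Hz; generalize (taylor_pseries g z Hz); now rewrite Hg.
Qed.

Lemma moment_Cesaro_op (m : nat) (f : H2) :
  moment m (taylor (Cesaro_op f)) =
    (RtoC (/ (INR m + 1)) * moment m (taylor f))%C.
Proof.
rewrite taylor_Cesaro, (moment_cesaro m (taylor f)), Cmult_assoc, <- RtoC_mult.
rewrite Rinv_l by (generalize (pos_INR m); lra); now rewrite Cmult_1_l.
Qed.

Definition Hardy_op (f : H2) : H2 := minus f (Cesaro_op f).

Lemma norm_Hardy_op (f : H2) : H2_norm (Hardy_op f) <= H2_norm f.
Proof.
unfold H2_norm, Hardy_op; rewrite taylor_minus, taylor_Cesaro.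
apply minus_cesaro_l2, taylor_sqsum.
Qed.

Lemma norm_iter_Hardy_op (j : nat) (f : H2) :
  H2_norm (Nat.iter j Hardy_op f) <= H2_norm f.
Proof.
induction j as [|j IH]; [apply Rle_refl|].
now apply Rle_trans with (1 := norm_Hardy_op _).
Qed.

Lemma moment_Hardy_op (m : nat) (f : H2) :
  moment m (taylor (Hardy_op f)) =
    (RtoC (1 - / (INR m + 1)) * moment m (taylor f))%C.
Proof.
etransitivity; [exact (linear_minus _ f (Cesaro_op f) (moment_linear m))|].
cbv beta; rewrite moment_Cesaro_op.
unfold minus, plus, opp; simpl; rewrite RtoC_minus; ring.
Qed.

Lemma moment_iter_Hardy_op (m j : nat) (f : H2) :
  moment m (taylor (Nat.iter j Hardy_op f)) =
    (RtoC ((1 - / (INR m + 1)) ^ j) * moment m (taylor f))%C.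
Proof.
induction j as [|j IH]; simpl Nat.iter; [simpl; ring|].
rewrite moment_Hardy_op, IH; simpl pow; rewrite RtoC_mult; ring.
Qed.

Lemma Lat_Hardy_op (M : H2 -> Prop) (f : H2) (j : nat) :
  Lat Cesaro_op M -> M f -> M (Nat.iter j Hardy_op f).
Proof.
intros [[_ [Hp [Hsc _]]] HC] Hf; induction j as [|j IH]; [exact Hf|].
apply (Hp (Nat.iter j Hardy_op f) (scal (- (1))%C (Cesaro_op (Nat.iter j Hardy_op f)))).
- exact IH.
- apply Hsc, HC, IH.
Qed.

(** Coefficients of the binomial series of [(1 - v)^beta]. *)
Fixpoint binom_coef (beta : C) (j : nat) : C :=
  match j with
  | O => 1
  | S j => (binom_coef beta j * (RtoC (INR j) - beta) * RtoC (/ INR (S j)))%C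
  end.

Lemma binom_coef_S (beta : C) (j : nat) : binom_coef beta (S j) =
  (binom_coef beta j * (RtoC (INR j) - beta) * RtoC (/ INR (S j)))%C.
Proof. reflexivity. Qed.

(* With [d = Re beta / 2], [(j + 1) |c (j+1)| <= (j - d) |c j|] for large [j], so
   [d |c j|] is dominated by the telescoping [j |c j| - (j + 1) |c (j+1)|]. *)
Lemma binom_coef_ex_series (beta : C) : 0 < Re beta ->
  ex_series (fun j => Cmod (binom_coef beta j)).
Proof.
destruct beta as [x y]; unfold Re; simpl fst; intros Hx.
set (c := binom_coef (x, y)).
(* The threshold: for $n\ge x+y^2/x$ one has $y^2\le x(n-x)$, which gives
   $|n-\beta|^2=(n-x)^2+y^2\le(n-x/2)^2$. *)
destruct (nfloor_ex (Rmax 0 (x + y ^ 2 / x))) as [J0 [_ HJ0]].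
{ apply Rmax_l. }
assert (HJ : x + y ^ 2 / x <= INR (S J0)).
{ rewrite S_INR; generalize (Rmax_r 0 (x + y ^ 2 / x)); lra. }
set (J := S J0) in *; clearbody J.
assert (Hc : forall j, INR (J + S j) * Cmod (c (J + S j)%nat) <=
  (INR (J + j) - x / 2) * Cmod (c (J + j)%nat)).
{ intros j; rewrite <- plus_n_Sm; unfold c; rewrite binom_coef_S.
  set (n := (J + j)%nat).
  assert (Hn : x + y ^ 2 / x <= INR n).
  { apply Rle_trans with (1 := HJ), le_INR; unfold n; lia. }
  assert (Hy : 0 <= y ^ 2 / x).
  { apply Rmult_le_pos; [apply pow2_ge_0|].
    now apply Rlt_le, Rinv_0_lt_compat. }
  rewrite !Cmod_mult, Cmod_R.
  assert (HS : 0 < INR (S n)) by (apply lt_0_INR; lia).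
  rewrite Rabs_pos_eq by now apply Rlt_le, Rinv_0_lt_compat.
  replace (INR (S n) * (Cmod (binom_coef (x, y) n) * Cmod (INR n - (x, y))%C
    * / INR (S n))) with
    (Cmod (INR n - (x, y))%C * Cmod (binom_coef (x, y) n)) by (field; lra).
  apply Rmult_le_compat_r; [apply Cmod_ge_0|].
  rewrite <- (sqrt_pow2 (INR n - x / 2)) by lra.
  unfold Cmod; apply sqrt_le_1_alt; simpl fst; simpl snd.
  assert (Hyx : y ^ 2 <= x * (INR n - x)).
  { apply Rle_trans with (x * (y ^ 2 / x)); [apply Req_le; field; lra|].
    apply Rmult_le_compat_l; lra. }
  nra. }
apply (ex_series_incr_n (K := R_AbsRing) (V := R_NormedModule)
  (fun j => Cmod (c j)) J).
apply (pos_series_bounded _ (2 / x * (INR J * Cmod (c J)))).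
{ intros n; apply Cmod_ge_0. }
intros N.
assert (Ht : Rsum (fun k => Cmod (c (J + k)%nat)) N <=
  2 / x * (INR J * Cmod (c J) - INR (J + S N) * Cmod (c (J + S N)%nat))).
{ assert (Hstep : forall j, Cmod (c (J + j)%nat) <= 2 / x *
    (INR (J + j) * Cmod (c (J + j)%nat) - INR (J + S j) * Cmod (c (J + S j)%nat))).
  { intros j; apply Rmult_le_reg_l with (x / 2); [lra|].
    rewrite <- Rmult_assoc; replace (x / 2 * (2 / x)) with 1 by (field; lra).
    generalize (Hc j); lra. }
  induction N as [|N IH].
  - rewrite sum_O; generalize (Hstep O); now rewrite Nat.add_0_r.
  - rewrite Rsum_S; generalize (Hstep (S N)); lra. }
apply Rle_trans with (1 := Ht).
apply Rmult_le_compat_l.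
- apply Rlt_le, Rdiv_lt_0_compat; lra.
- generalize (Rmult_le_pos _ _ (pos_INR (J + S N)) (Cmod_ge_0 (c (J + S N)%nat))); lra.
Qed.

(** * Summation of the binomial series *)

Lemma CV_radius_ge_1 (a : nat -> R) :
  ex_series (fun n => Rabs (a n)) -> Rbar_le 1 (CV_radius a).
Proof.
intros Ha; apply (CV_radius_bounded a).
exists (Series (fun n => Rabs (a n))); intros n; rewrite pow1, Rmult_1_r.
apply (pos_series_term (fun n => Rabs (a n))); auto; intros; apply Rabs_pos.
Qed.

Lemma binom_coef_Cpart (beta : C) (i : bool) : 0 < Re beta ->
  Rbar_le 1 (CV_radius (fun j => Cpart i (binom_coef beta j))).
Proof.
intros Hb; apply CV_radius_ge_1.
apply (ex_series_le (K := R_AbsRing) (V := R_CompleteNormedModule) _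
  (fun j => Cmod (binom_coef beta j))); [|now apply binom_coef_ex_series].
intros n; change (Rabs (Rabs (Cpart i (binom_coef beta n)))
  <= Cmod (binom_coef beta n)).
rewrite Rabs_Rabsolu; apply Rle_trans with (2 := Rmax_Cmod _).
destruct i; [apply Rmax_l|apply Rmax_r].
Qed.

(** The real part of $(1-v)F'=-\beta F$, the equation of $(1-v)^\beta$, read off the coefficient
    recursion. The imaginary part is the same statement with [a] and [b] exchanged and [y]
    negated. *)
Lemma PSeries_ode (a b : nat -> R) (x y v : R) :
  Rbar_lt (Rabs v) (CV_radius a) -> Rbar_lt (Rabs v) (CV_radius b) ->
  (forall n, INR (S n) * a (S n) = (INR n - x) * a n + y * b n) ->
  (1 - v) * PSeries (PS_derive a) v = - x * PSeries a v + y * PSeries b v.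
Proof.
intros Ha Hb H.
assert (E : PSeries (PS_derive a) v = PSeries (PS_plus (PS_incr_1 (PS_derive a))
  (PS_plus (PS_scal (- x) a) (PS_scal y b))) v).
{ apply PSeries_ext; intros n; unfold PS_derive at 1; rewrite H.
  unfold PS_plus, PS_incr_1, PS_scal, PS_derive, plus, scal, zero; simpl.
  unfold mult; simpl; destruct n as [|n]; simpl; ring. }
assert (Ha' : ex_pseries (PS_derive a) v) by now apply ex_pseries_derive.
assert (Hxa : ex_pseries (PS_scal (- x) a) v).
{ apply ex_pseries_scal; [apply Rmult_comm|now apply CV_radius_inside]. }
assert (Hyb : ex_pseries (PS_scal y b) v).
{ apply ex_pseries_scal; [apply Rmult_comm|now apply CV_radius_inside]. }
rewrite PSeries_plus, PSeries_incr_1, PSeries_plus, !PSeries_scal in E; auto.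
- lra.
- now apply ex_pseries_incr_1.
- apply (ex_pseries_plus (K := R_AbsRing) (V := R_NormedModule)); auto.
Qed.

Lemma binom_coef_rec (beta : C) (n : nat) :
  INR (S n) * fst (binom_coef beta (S n)) =
    (INR n - Re beta) * fst (binom_coef beta n) + Im beta * snd (binom_coef beta n) /\
  INR (S n) * snd (binom_coef beta (S n)) =
    (INR n - Re beta) * snd (binom_coef beta n) + - Im beta * fst (binom_coef beta n).
Proof.
rewrite binom_coef_S; generalize (binom_coef beta n); intros [a b].
destruct beta as [x y].
assert (INR (S n) <> 0) by (apply not_0_INR; lia).
unfold Re, Im, Cmult, Cminus, Cplus, Copp, RtoC; cbn [fst snd].
split; field; auto.
Qed.

Lemma binom_series_parts (beta : C) (v : R) : 0 < Re beta -> 0 <= v < 1 ->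
  PSeries (fun j => fst (binom_coef beta j)) v =
    exp (Re beta * ln (1 - v)) * cos (Im beta * ln (1 - v)) /\
  PSeries (fun j => snd (binom_coef beta j)) v =
    exp (Re beta * ln (1 - v)) * sin (Im beta * ln (1 - v)).
Proof.
intros Hb Hv.
set (a := fun j => fst (binom_coef beta j)).
set (b := fun j => snd (binom_coef beta j)).
set (x := Re beta) in *; set (y := Im beta).
assert (Ra : forall u, 0 <= u <= v -> Rbar_lt (Rabs u) (CV_radius a)).
{ intros u Hu; apply Rbar_lt_le_trans with (2 := binom_coef_Cpart beta true Hb).
  simpl; rewrite Rabs_pos_eq; lra. }
assert (Rb : forall u, 0 <= u <= v -> Rbar_lt (Rabs u) (CV_radius b)).
{ intros u Hu; apply Rbar_lt_le_trans with (2 := binom_coef_Cpart beta false Hb).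
  simpl; rewrite Rabs_pos_eq; lra. }
assert (Da : forall u, 0 <= u <= v ->
  is_derive (PSeries a) u ((- x * PSeries a u + y * PSeries b u) / (1 - u))).
{ intros u Hu; rewrite <- (PSeries_ode a b x y u); auto.
  - replace ((1 - u) * PSeries (PS_derive a) u / (1 - u))
      with (PSeries (PS_derive a) u) by (field; lra).
    apply is_derive_PSeries; auto.
  - intros n; apply (binom_coef_rec beta n). }
assert (Db : forall u, 0 <= u <= v ->
  is_derive (PSeries b) u ((- x * PSeries b u + - y * PSeries a u) / (1 - u))).
{ intros u Hu; rewrite <- (PSeries_ode b a x (- y) u); auto.
  - replace ((1 - u) * PSeries (PS_derive b) u / (1 - u))
      with (PSeries (PS_derive b) u) by (field; lra).
    apply is_derive_PSeries; auto.
  - intros n; apply (binom_coef_rec beta n). }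
assert (a0 : PSeries a 0 = 1) by (rewrite PSeries_0; reflexivity).
assert (b0 : PSeries b 0 = 0) by (rewrite PSeries_0; reflexivity).
(* [F] and [G] are the real and imaginary parts of $(1-u)^{-\beta}$ times the series. The
   differential equation makes the product constant, hence equal to its value 1 at 0; the rotation
   is undone at the end. *)
set (F := fun u => exp (- x * ln (1 - u)) *
  (PSeries a u * cos (y * ln (1 - u)) + PSeries b u * sin (y * ln (1 - u)))).
set (G := fun u => exp (- x * ln (1 - u)) *
  (PSeries b u * cos (y * ln (1 - u)) - PSeries a u * sin (y * ln (1 - u)))).
assert (E : F v = 1 /\ G v = 0).
{ destruct (Req_dec v 0) as [->|Hv0].
  { unfold F, G; rewrite a0, b0, Rminus_0_r, ln_1, !Rmult_0_r, exp_0, cos_0, sin_0.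
    lra. }
  split.
  - replace 1 with (F 0).
    2: { unfold F; rewrite a0, b0, Rminus_0_r, ln_1, !Rmult_0_r, exp_0, cos_0, sin_0.
         ring. }
    symmetry; apply (eq_is_derive (V := R_NormedModule)); [|lra].
    intros u Hu; unfold F; generalize (Da u Hu) (Db u Hu); intros H1 H2.
    evar_last.
    { auto_derive; [|reflexivity]; repeat split; try lra.
      - now exists ((- x * PSeries a u + y * PSeries b u) / (1 - u)).
      - now exists ((- x * PSeries b u + - y * PSeries a u) / (1 - u)). }
    change (fun x => PSeries a x) with (PSeries a).
    change (fun x => PSeries b x) with (PSeries b).
    rewrite (is_derive_unique _ _ _ H1), (is_derive_unique _ _ _ H2).
    unfold zero; simpl; field; lra.
  - replace 0 with (G 0).
    2: { unfold G; rewrite a0, b0, Rminus_0_r, ln_1, !Rmult_0_r, exp_0, cos_0, sin_0.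
         ring. }
    symmetry; apply (eq_is_derive (V := R_NormedModule)); [|lra].
    intros u Hu; unfold G; generalize (Da u Hu) (Db u Hu); intros H1 H2.
    evar_last.
    { auto_derive; [|reflexivity]; repeat split; try lra.
      - now exists ((- x * PSeries b u + - y * PSeries a u) / (1 - u)).
      - now exists ((- x * PSeries a u + y * PSeries b u) / (1 - u)). }
    change (fun x => PSeries a x) with (PSeries a).
    change (fun x => PSeries b x) with (PSeries b).
    rewrite (is_derive_unique _ _ _ H1), (is_derive_unique _ _ _ H2).
    unfold zero; simpl; field; lra. }
destruct E as [EF EG]; unfold F, G in EF, EG.
assert (He : exp (x * ln (1 - v)) * exp (- x * ln (1 - v)) = 1).
{ rewrite <- exp_plus, <- exp_0; f_equal; ring. }
generalize (sin2_cos2 (y * ln (1 - v))); unfold Rsqr; intros Hcs.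
set (e := exp (x * ln (1 - v))) in *; set (e' := exp (- x * ln (1 - v))) in *.
set (A := PSeries a v) in *; set (B := PSeries b v) in *.
set (co := cos (y * ln (1 - v))) in *; set (si := sin (y * ln (1 - v))) in *.
assert (EF' : A * co + B * si = e).
{ transitivity ((e * e') * (A * co + B * si)); [rewrite He; ring|].
  rewrite Rmult_assoc, EF; ring. }
assert (EG' : B * co - A * si = 0).
{ transitivity ((e * e') * (B * co - A * si)); [rewrite He; ring|].
  rewrite Rmult_assoc, EG; ring. }
split.
- transitivity (A * (si * si + co * co)); [rewrite Hcs; ring|].
  rewrite <- EF'; transitivity
    ((A * co + B * si) * co - si * (B * co - A * si)); [ring|rewrite EG'; ring].
- transitivity (B * (si * si + co * co)); [rewrite Hcs; ring|].
  rewrite <- EF'; transitivity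
    ((A * co + B * si) * si + co * (B * co - A * si)); [ring|rewrite EG'; ring].
Qed.

Lemma binom_series (beta : C) (v : R) : 0 < Re beta -> 0 <= v < 1 ->
  is_series (K := C_AbsRing) (V := C_NormedModule)
    (fun j => binom_coef beta j * RtoC (v ^ j))%C (Rcpow (1 - v) beta).
Proof.
intros Hb Hv.
destruct (ex_series_le (K := C_AbsRing) (V := C_CompleteNormedModule)
  (fun j => binom_coef beta j * RtoC (v ^ j))%C
  (fun j => Cmod (binom_coef beta j))) as [l Hl].
- intros n; change (Cmod (binom_coef beta n * RtoC (v ^ n))%C
    <= Cmod (binom_coef beta n)).
  rewrite Cmod_mult, Cmod_R, <- RPow_abs, Rabs_pos_eq by lra.
  generalize (Cmod_ge_0 (binom_coef beta n)) (pow_incr v 1 n).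
  rewrite pow1; nra.
- now apply binom_coef_ex_series.
- replace (Rcpow (1 - v) beta) with l; [exact Hl|].
  destruct (binom_series_parts beta v Hb Hv) as [Hr Hi].
  generalize (is_series_unique _ _ (is_series_Cpart true _ _ Hl)).
  generalize (is_series_unique _ _ (is_series_Cpart false _ _ Hl)).
  simpl Cpart; intros E2 E1.
  rewrite (surjective_pairing l), <- E1, <- E2.
  transitivity (PSeries (fun j => fst (binom_coef beta j)) v,
    PSeries (fun j => snd (binom_coef beta j)) v).
  + f_equal; apply Series_ext; intros n; simpl; ring.
  + rewrite Hr, Hi; unfold Rcpow, Cexp.
    destruct beta as [x y]; unfold Cmult, RtoC, Re, Im; cbn [fst snd].
    replace (x * ln (1 - v) - y * 0) with (x * ln (1 - v)) by ring.
    replace (x * 0 + y * ln (1 - v)) with (y * ln (1 - v)) by ring.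
    f_equal; ring.
Qed.

(* [(I - V)^beta] as a norm convergent binomial series in the contraction
   [V = I - C]. *)
Lemma binom_series_op (M : H2 -> Prop) (beta : C) (f : H2) :
  0 < Re beta -> Lat Cesaro_op M -> M f ->
  exists g, M g /\ forall m, moment m (taylor g) =
    (Rcpow (/ (INR m + 1)) beta * moment m (taylor f))%C.
Proof.
intros Hb HM Hf.
destruct (ex_series_le (K := C_AbsRing) (V := H2_CompleteNormedModule)
  (fun j => scal (binom_coef beta j) (Nat.iter j Hardy_op f))
  (fun j => Cmod (binom_coef beta j) * H2_norm f)) as [g Hg].
- intros n; change (H2_norm (H2_scal (binom_coef beta n) (Nat.iter n Hardy_op f))
    <= Cmod (binom_coef beta n) * H2_norm f).
  rewrite H2_norm_scal; apply Rmult_le_compat_l; [apply Cmod_ge_0|].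
  apply norm_iter_Hardy_op.
- apply ex_series_scal_r; now apply binom_coef_ex_series.
- exists g; split.
  + apply (closed_filterlim (F := eventually) _ M g Hg); [|apply HM].
    intros n; induction n as [|n IH]; destruct HM as [[HM0 [HMp [HMs HMc]]] HMC].
    * rewrite sum_O; now apply HMs, Lat_Hardy_op.
    * rewrite sum_Sn; apply HMp; [exact IH|].
      apply HMs, Lat_Hardy_op; repeat split; auto.
  + intros m; generalize (linear_is_series _ _ _ (moment_linear m) Hg); intros H1.
    apply (is_series_C_unique _ _ _ H1).
    (* Under [moment m] the operator $V$ becomes the scalar $v=1-1/(m+1)$, and the scalar series
       sums to $(1-v)^\beta$. *)
    assert (Hv : 0 <= 1 - / (INR m + 1) < 1).
    { generalize (pos_INR m); intros Hp.
      assert (0 < / (INR m + 1)) by (apply Rinv_0_lt_compat; lra).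
      assert (/ (INR m + 1) <= / 1) by (apply Rinv_le_contravar; lra).
      rewrite Rinv_1 in *; lra. }
    generalize (is_series_scal (K := C_AbsRing) (V := C_NormedModule) (moment m (taylor f)) _ _
      (binom_series beta _ Hb Hv)).
    replace (1 - (1 - / (INR m + 1))) with (/ (INR m + 1)) by ring.
    rewrite (Cmult_comm (Rcpow _ _)); apply is_series_ext; intros n.
    etransitivity; [|symmetry; exact (linear_scal _ (moment_linear m)
      (binom_coef beta n) (Nat.iter n Hardy_op f))].
    cbv beta; rewrite moment_iter_Hardy_op.
    unfold scal; simpl; unfold mult; simpl; ring.
Qed.

(** * Improper integrals *)

Lemma is_RInt_linear {U V : NormedModule R_AbsRing} (l : U -> V) (f : R -> U)
  (a b : R) (x : U) : is_linear l ->
  is_RInt f a b x -> is_RInt (fun t => l (f t)) a b (l x).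
Proof.
intros Hl Hf; unfold is_RInt.
apply filterlim_ext with
  (fun ptd => l (scal (sign (b - a)) (Riemann_sum f ptd))).
- intros ptd; rewrite (linear_scal l Hl); f_equal.
  apply (SF_cons_ind (fun s => l (Riemann_sum f s) =
    Riemann_sum (fun t => l (f t)) s)).
  + intros x0; exact (linear_zero l Hl).
  + intros h s IH.
    now rewrite !Riemann_sum_cons, (linear_plus l Hl), (linear_scal l Hl), IH.
- apply filterlim_comp with (1 := Hf); now apply linear_cont.
Qed.

Lemma is_RInt_gen_linear {U V : NormedModule R_AbsRing} (l : U -> V)
  (f : R -> U) (Fa Fb : (R -> Prop) -> Prop) (x : U) :
  Filter Fa -> Filter Fb -> is_linear l ->
  is_RInt_gen f Fa Fb x -> is_RInt_gen (fun t => l (f t)) Fa Fb (l x).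
Proof.
intros FFa FFb Hl Hf P HP.
generalize (Hf (fun y => P (l y)) (linear_cont l x Hl P HP)).
unfold filtermapi; apply filter_imp; intros ab [y [Hy1 Hy2]].
exists (l y); split; [now apply is_RInt_linear|exact Hy2].
Qed.

Lemma at_right_0_pos : at_right 0 (fun t => 0 < t).
Proof. exists (mkposreal 1 Rlt_0_1); auto. Qed.

Lemma ends_pos : filter_prod (at_right 0) (Rbar_locally p_infty)
  (fun ab => 0 < fst ab /\ 0 < snd ab).
Proof.
apply Filter_prod with (fun a => 0 < a) (fun b => 0 < b).
- apply at_right_0_pos.
- exists 0; auto.
- auto.
Qed.

(** The absolute value covers both orientations of the interval, since endpoints move either way in
    the Cauchy criterion. *)
Lemma norm_RInt_le_primitive {V : CompleteNormedModule R_AbsRing}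
  (h : R -> V) (G g : R -> R) (a b : R) :
  (forall t, 0 < t -> continuous h t) ->
  (forall t, 0 < t -> is_derive G t (g t)) ->
  (forall t, 0 < t -> continuous g t) ->
  (forall t, 0 < t -> norm (h t) <= g t) -> 0 < a -> 0 < b ->
  norm (RInt h a b) <= Rabs (G b - G a).
Proof.
intros Hh HG Hg Hle.
assert (Hw : forall a b, 0 < a -> a <= b -> norm (RInt h a b) <= Rabs (G b - G a)).
{ clear a b; intros a b Ha Hab.
  apply Rle_trans with (2 := Rle_abs _).
  apply (norm_RInt_le h g a b); auto.
  - intros x Hx; apply Hle; lra.
  - apply RInt_correct, ex_RInt_continuous; rewrite Rmin_left by lra.
    intros z Hz; apply Hh; lra.
  - apply (is_RInt_derive (V := R_CompleteNormedModule) G g); rewrite Rmin_left by lra;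
      intros x Hx; [apply HG|apply Hg]; lra. }
intros Ha Hb; destruct (Rle_lt_dec a b) as [Hab|Hab]; [now apply Hw|].
rewrite <- opp_RInt_swap, Rabs_minus_sym.
- apply Rle_trans with (norm (RInt h b a)); [|apply Hw; lra].
  apply Req_le, (norm_opp (V := V)).
- apply ex_RInt_continuous; rewrite Rmin_left by lra.
  intros z Hz; apply Hh; lra.
Qed.

Lemma plus_minus_middle {G : AbelianGroup} (x y z : G) :
  plus x y = minus (plus x (plus z y)) z.
Proof.
unfold minus; rewrite (plus_comm z y), (plus_assoc x y z).
now rewrite <- (plus_assoc (plus x y)), plus_opp_r, plus_zero_r.
Qed.

(** Moving the two endpoints changes the integral by at most the change of the primitive [G] there,
    which is small because [G] has limits at both ends. *)
Lemma ex_RInt_gen_dominated {V : CompleteNormedModule R_AbsRing}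
  (h : R -> V) (G g : R -> R) (la lb : R) :
  (forall t, 0 < t -> continuous h t) ->
  (forall t, 0 < t -> is_derive G t (g t)) ->
  (forall t, 0 < t -> continuous g t) ->
  (forall t, 0 < t -> norm (h t) <= g t) ->
  filterlim G (at_right 0) (locally la) ->
  filterlim G (Rbar_locally p_infty) (locally lb) ->
  ex_RInt_gen h (at_right 0) (Rbar_locally p_infty).
Proof.
intros Hh HG Hg Hle Hla Hlb.
assert (Hex : forall a b, 0 < a -> 0 < b -> ex_RInt h a b).
{ intros a b Ha Hb; apply ex_RInt_continuous; intros z Hz; apply Hh.
  apply Rlt_le_trans with (2 := proj1 Hz); now apply Rmin_glb_lt. }
assert (Hc : exists y, filterlim (fun ab => RInt h (fst ab) (snd ab))
  (filter_prod (at_right 0) (Rbar_locally p_infty)) (locally y)).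
{ apply filterlim_locally_cauchy; intros e.
  assert (He : 0 < e / 4) by (generalize (cond_pos e); lra).
  set (e4 := mkposreal _ He).
  exists (fun ab => (0 < fst ab /\ ball la e4 (G (fst ab))) /\
    (0 < snd ab /\ ball lb e4 (G (snd ab)))); split.
  - apply Filter_prod with (fun a => 0 < a /\ ball la e4 (G a))
      (fun b => 0 < b /\ ball lb e4 (G b)).
    + apply filter_and; [apply at_right_0_pos|].
      exact (proj1 (filterlim_locally _ _) Hla e4).
    + apply filter_and; [exists 0; auto|].
      exact (proj1 (filterlim_locally _ _) Hlb e4).
    + auto.
  - intros [a b] [a' b']; cbn [fst snd]; intros [[Ha Ga] [Hb Gb]] [[Ha' Ga'] [Hb' Gb']].
    change (Rabs (G a - la) < e / 4) in Ga; change (Rabs (G a' - la) < e / 4) in Ga'.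
    change (Rabs (G b - lb) < e / 4) in Gb; change (Rabs (G b' - lb) < e / 4) in Gb'.
    apply (norm_compat1 (V := V)).
    change (norm (minus (RInt h a' b') (RInt h a b)) < e).
    replace (minus (RInt h a' b') (RInt h a b)) with
      (plus (RInt h a' a) (RInt h b b')).
    + apply Rle_lt_trans with (1 := norm_triangle (V := V) _ _).
      apply Rle_lt_trans with (Rabs (G a - G a') + Rabs (G b' - G b)).
      * apply Rplus_le_compat; apply (norm_RInt_le_primitive h G g); auto.
      * revert Ga Ga' Gb Gb'; unfold Rabs; repeat destruct Rcase_abs; lra.
    + rewrite <- (RInt_Chasles h a' a b') by auto.
      rewrite <- (RInt_Chasles h a b b') by auto.
      exact (plus_minus_middle (G := V) _ _ _). }
destruct Hc as [y Hy]; exists y; unfold is_RInt_gen.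
apply filterlimi_lim_ext_loc with (2 := Hy).
generalize ends_pos; apply filter_imp; intros ab [Ha Hb].
now apply RInt_correct, Hex.
Qed.

(** The decay $e^{-t/2}$ is what $e^{-t}$ leaves after the growth $e^{t/2}$ of the semigroup. *)
Lemma ex_RInt_gen_gamma {V : CompleteNormedModule R_AbsRing}
  (h : R -> V) (b B : R) : 0 < b -> 0 <= B ->
  (forall t, 0 < t -> continuous h t) ->
  (forall t, 0 < t -> norm (h t) <= B * exp (- t / 2 + (b - 1) * ln t)) ->
  ex_RInt_gen h (at_right 0) (Rbar_locally p_infty).
Proof.
intros Hb HB Hh Hle.
(* The concave logarithm lies below its tangent at [c]. With this [c], multiplying by [b + 1] gives
   slope 1/2, which $e^{-t/2}$ compensates; the leftover constants make up [K]. *)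
set (c := 2 * (b + 1)).
set (K := B * exp (1 / 2 + (b + 1) * (ln c - 1)) / b).
assert (HK : 0 <= K).
{ apply Rmult_le_pos; [|now apply Rlt_le, Rinv_0_lt_compat].
  apply Rmult_le_pos; auto; apply Rlt_le, exp_pos. }
(* [(t / (1 + t))^b] is a primitive of [b t^(b-1) / (1 + t)^(b+1)], which
   dominates [t^(b-1) e^(-t/2)] up to a constant. *)
set (E := fun t => exp (b * (ln t - ln (1 + t)))).
apply (ex_RInt_gen_dominated h (fun t => K * E t)
  (fun t => K * (b * (/ t - / (1 + t)) * E t)) (K * 0) (K * 1)); auto.
- intros t Ht; unfold E; auto_derive; [repeat split; lra|]; unfold Rminus; field; lra.
- intros t Ht; apply (ex_derive_continuous (fun t => K * (b * (/ t - / (1 + t)) * E t))).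
  unfold E; auto_derive; repeat split; lra.
- intros t Ht; apply Rle_trans with (1 := Hle t Ht).
  assert (Hln : ln (1 + t) <= (1 + t) / c + ln c - 1).
  { assert (Hc : 0 < c) by (unfold c; lra).
    assert (Hd : 0 < (1 + t) / c) by (apply Rdiv_lt_0_compat; lra).
    replace (1 + t) with ((1 + t) / c * c) at 1 by (field; lra).
    rewrite ln_mult by lra.
    generalize (exp_ineq1_le (ln ((1 + t) / c))); rewrite exp_ln by lra; lra. }
  replace (K * (b * (/ t - / (1 + t)) * E t)) with
    (B * exp (1 / 2 + (b + 1) * (ln c - 1) + ((b - 1) * ln t - (b + 1) * ln (1 + t)))).
  + apply Rmult_le_compat_l; [exact HB|].
    apply Rnot_lt_le; intros H.
    apply exp_lt_inv in H; revert H; apply Rle_not_lt.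
    assert (H : (b + 1) * ln (1 + t) <= (1 + t) / 2 + (b + 1) * (ln c - 1)).
    { apply Rle_trans with ((b + 1) * ((1 + t) / c + ln c - 1)).
      - apply Rmult_le_compat_l; lra.
      - apply Req_le; unfold c; field; lra. }
    lra.
  + rewrite exp_plus.
    replace ((b - 1) * ln t - (b + 1) * ln (1 + t)) with
      (b * (ln t - ln (1 + t)) + (- ln t + - ln (1 + t))) by ring.
    rewrite !exp_plus, !exp_Ropp, !exp_ln by lra.
    unfold K, E; rewrite exp_plus; field; lra.
- apply (filterlim_comp _ _ _ E (fun x => K * x) _ (locally 0)).
  2: { exact (filterlim_scal_r (K := R_AbsRing) (V := R_NormedModule) K 0). }
  apply filterlim_locally; intros e.
  (* The radius is $e^{1/b}$ for the given tolerance, since $(t/(1+t))^b<t^b$. *)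
  exists (mkposreal _ (exp_pos (ln e / b))); intros t Ht Ht0.
  change (Rabs (t - 0) < exp (ln e / b)) in Ht.
  rewrite Rminus_0_r, Rabs_pos_eq in Ht by lra.
  change (Rabs (E t - 0) < e); rewrite Rminus_0_r, Rabs_pos_eq
    by (apply Rlt_le, exp_pos).
  rewrite <- (exp_ln e) by apply cond_pos; apply exp_increasing.
  apply ln_increasing in Ht; [|exact Ht0]; rewrite ln_exp in Ht.
  assert (H1 : 0 < ln (1 + t)) by (rewrite <- ln_1; apply ln_increasing; lra).
  apply Rlt_le_trans with (b * (ln e / b)); [|apply Req_le; field; lra].
  apply Rmult_lt_compat_l; lra.
- apply (filterlim_comp _ _ _ E (fun x => K * x) _ (locally 1)).
  2: { exact (filterlim_scal_r (K := R_AbsRing) (V := R_NormedModule) K 1). }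
  apply filterlim_locally; intros e.
  (* From $1-b/t\le(t/(1+t))^b\le 1$. *)
  exists (b / e); intros t Ht.
  assert (Hbe : 0 < b / e) by (apply Rdiv_lt_0_compat; [lra|apply cond_pos]).
  assert (Ht0 : 0 < t) by lra.
  assert (Hl : ln (1 + t) - ln t <= / t).
  { rewrite <- ln_div by lra.
    assert (0 < (1 + t) / t) by (apply Rdiv_lt_0_compat; lra).
    generalize (exp_ineq1_le (ln ((1 + t) / t))); rewrite exp_ln by lra.
    replace ((1 + t) / t) with (1 + / t) by (field; lra); lra. }
  assert (Hl' : ln t < ln (1 + t)) by (apply ln_increasing; lra).
  assert (H1 : E t <= 1).
  { rewrite <- exp_0; apply Rlt_le, exp_increasing; nra. }
  generalize (exp_ineq1_le (b * (ln t - ln (1 + t)))); fold (E t); intros H2.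
  change (Rabs (E t - 1) < e); rewrite Rabs_left1 by lra.
  assert (H3 : b * / t < e).
  { apply Rmult_lt_reg_r with t; [lra|].
    rewrite Rmult_assoc, Rinv_l, Rmult_1_r by lra.
    apply Rmult_lt_reg_l with (/ e); [apply Rinv_0_lt_compat, cond_pos|].
    rewrite <- Rmult_assoc, Rinv_l, Rmult_1_l
      by (generalize (cond_pos e); lra).
    unfold Rdiv in Ht; lra. }
  assert (H4 : b * (ln (1 + t) - ln t) <= b * / t)
    by (apply Rmult_le_compat_l; lra).
  lra.
Qed.

Lemma is_RInt_gen_scale {V : NormedModule R_AbsRing} (f : R -> V) (c : R) (l : V) :
  0 < c -> is_RInt_gen f (at_right 0) (Rbar_locally p_infty) l ->
  is_RInt_gen (fun t => scal c (f (c * t))) (at_right 0) (Rbar_locally p_infty) l.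
Proof.
intros Hc Hf P HP; destruct (Hf P HP) as [Q S HQ HS HQS].
apply Filter_prod with (fun a => Q (c * a)) (fun b => S (c * b)).
- destruct HQ as [d Hd].
  assert (Hdc : 0 < d / c) by (apply Rdiv_lt_0_compat; [apply cond_pos|lra]).
  exists (mkposreal _ Hdc); intros t Ht Ht0.
  change (Rabs (t - 0) < d / c) in Ht.
  apply Hd; [|apply Rmult_lt_0_compat; lra].
  change (Rabs (c * t - 0) < d); rewrite Rminus_0_r, Rabs_pos_eq in * by nra.
  apply Rmult_lt_compat_l with (r := c) in Ht; [|lra].
  replace (c * (d / c)) with (pos d) in Ht by (field; lra); exact Ht.
- destruct HS as [m Hm]; exists (m / c); intros t Ht; apply Hm.
  apply Rmult_lt_compat_l with (r := c) in Ht; [|lra].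
  replace (c * (m / c)) with m in Ht by (field; lra); exact Ht.
- intros a b Ha Hb; destruct (HQS _ _ Ha Hb) as [y [Hy1 Hy2]].
  exists y; split; [|exact Hy2]; cbn [fst snd] in *.
  apply is_RInt_ext with (fun t => scal c (f (c * t + 0))).
  + intros t _; now rewrite Rplus_0_r.
  + apply (is_RInt_comp_lin f c 0); now rewrite !Rplus_0_r.
Qed.

(** * Norm continuity of the adjoint semigroup *)

Lemma bern_le1 (s : R) (k j : nat) : 0 <= s <= 1 -> bern s k j <= 1.
Proof.
intros Hs; apply Rle_trans with (2 := bern_row s k j Hs).
destruct j as [|j]; [rewrite sum_O; apply Rle_refl|].
rewrite Rsum_S.
generalize (Rsum_ge0 (bern s k) j (fun i => bern_ge0 s k i Hs)); lra.
Qed.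

(** The image of $z^j$ under the adjoint of $C_{\varphi_t}$, for $s=e^{-t}$: a column of the
    matrix. *)
Definition bern_col_op (s : R) (j : nat) : H2 :=
  of_taylor (fun n => RtoC (bern s n j)).

Lemma taylor_bern_col_op (s : R) (j : nat) : 0 < s <= 1 ->
  taylor (bern_col_op s j) = fun n => RtoC (bern s n j).
Proof.
intros Hs; apply taylor_of_taylor.
assert (Hs' : 0 < / s) by (apply Rinv_0_lt_compat; lra).
apply (sqsum_bounded _ (sqrt (/ s))); [|apply sqrt_pos].
intros N; rewrite pow2_sqrt by lra.
apply Rle_trans with (2 := bern_col s j N Hs); apply Rsum_le; intros n _.
rewrite Cmod_R, pow2_abs.
generalize (bern_ge0 s n j) (bern_le1 s n j); nra.
Qed.

Lemma continuous_sum_n {U : UniformSpace} {K : AbsRing} {V : NormedModule K}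
  (u : U -> nat -> V) (N : nat) (x : U) :
  (forall n, continuous (fun y => u y n) x) ->
  continuous (fun y => sum_n (u y) N) x.
Proof.
intros Hu; induction N as [|N IH].
- apply continuous_ext with (fun y => u y O); auto.
  intros y; now rewrite sum_O.
- apply continuous_ext with (fun y => plus (sum_n (u y) N) (u y (S N))).
  + intros y; now rewrite sum_Sn.
  + now apply (continuous_plus (V := V)).
Qed.

Lemma Rsum_le_tail (u d : nat -> R) (N K : nat) (F e : R) :
  (forall n, 0 <= u n) -> (forall n, 0 <= d n) -> (forall n, u n <= d n) ->
  Rsum u N <= F -> 0 <= e ->
  (forall m, (N <= m)%nat -> sum_n_m (G := R_AbelianMonoid) d N m <= e) ->
  Rsum u K <= F + e.
Proof.
intros Hu Hd Hud HF He Ht.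
destruct (le_lt_dec K N) as [HK|HK].
- apply Rle_trans with (Rsum u N); [|lra].
  clear -HK Hu; induction HK as [|N HK IH]; [apply Rle_refl|].
  rewrite Rsum_S; generalize (Hu (S N)); lra.
- apply Rle_trans with (F + sum_n_m (G := R_AbelianMonoid) d N K);
    [|apply Rplus_le_compat_l, Ht; lia].
  assert (HK' : (N <= K)%nat) by lia; clear HK.
  induction HK' as [|K HK IH].
  + rewrite sum_n_n; generalize (Hd N); lra.
  + rewrite Rsum_S, sum_n_Sm by lia.
    generalize (Hud (S K)); unfold plus; simpl; lra.
Qed.

(** Dominated convergence in $\ell^2$: finitely many entries are polynomials in [s], and the tail is
    controlled by [bern_domin] with $s_0=s/2$. Entries lie in $[0,1]$, so squared differences are at
    most plain ones and a majorant in $\ell^1$ suffices. *)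
Lemma bern_col_op_continuous (s : R) (j : nat) : 0 < s < 1 ->
  continuous (fun s => bern_col_op s j : H2_UniformSpace) s.
Proof.
intros Hs.
assert (Hs0 : 0 < s / 2 <= 1) by lra.
set (d := fun n => bern (s / 2) n j / (s / 2) ^ j).
assert (Hp : 0 < (s / 2) ^ j) by (apply pow_lt; lra).
assert (Hd0 : forall n, 0 <= d n).
{ intros n; apply Rmult_le_pos; [apply bern_ge0; lra|].
  now apply Rlt_le, Rinv_0_lt_compat. }
assert (Hd : ex_series d).
{ apply (ex_series_scal_r (/ (s / 2) ^ j)).
  apply (pos_series_bounded _ (/ (s / 2))).
  - intros n; apply bern_ge0; lra.
  - intros N; now apply bern_col. }
apply filterlim_locally; intros e.
assert (He : 0 < e ^ 2 / 4) by (generalize (pow_lt e 2 (cond_pos e)); lra).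
destruct (Cauchy_ex_series (K := R_AbsRing) (V := R_CompleteNormedModule)
  _ Hd (mkposreal _ He)) as [N HN].
set (F := fun s' => Rsum (fun n => (bern s' n j - bern s n j) ^ 2) N).
assert (HF : continuous F s).
{ apply (continuous_sum_n (K := R_AbsRing) (V := R_NormedModule)
    (fun s' n => (bern s' n j - bern s n j) ^ 2)).
  intros n; apply continuous_ext with (fun s' => (bern s' n j - bern s n j) *
    (bern s' n j - bern s n j)); [intros x; simpl; cring|].
  assert (Hc : continuous (fun s' => bern s' n j - bern s n j) s).
  { apply (continuous_minus (V := R_NormedModule));
      [apply bern_continuous|apply continuous_const]. }
  now apply (continuous_mult (K := R_AbsRing)). }
assert (HFs : F s = 0).
{ unfold F; rewrite (sum_n_ext _ (fun _ => 0)) by (intros; cring).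
  rewrite sum_n_const; apply Rmult_0_r. }
(* This radius keeps [s'] between [s / 2] and 1, where the majorant is valid. *)
assert (Hd1 : 0 < Rmin (s / 2) (1 - s)) by (apply Rmin_glb_lt; lra).
generalize (filter_and _ _ (proj1 (filterlim_locally _ _) HF (mkposreal _ He))
  (locally_ball s (mkposreal _ Hd1))).
apply filter_imp; intros s' [HFs' Hs'].
change (Rabs (F s' - F s) < e ^ 2 / 4) in HFs'.
rewrite HFs, Rminus_0_r in HFs'; apply Rle_lt_trans with (1 := Rle_abs _) in HFs'.
change (Rabs (s' - s) < Rmin (s / 2) (1 - s)) in Hs'.
apply Rabs_lt_between in Hs'.
generalize (Rmin_l (s / 2) (1 - s)) (Rmin_r (s / 2) (1 - s)); intros Hm1 Hm2.
change (H2_norm (minus (bern_col_op s' j) (bern_col_op s j)) < e).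
assert (He2 : 0 < e ^ 2) by (apply pow_lt, cond_pos).
apply Rle_lt_trans with (sqrt (e ^ 2 / 2)).
2: { rewrite <- (sqrt_pow2 e) at 2 by apply Rlt_le, cond_pos.
     apply sqrt_lt_1_alt; lra. }
unfold H2_norm; rewrite taylor_minus, !taylor_bern_col_op by lra.
apply sqsum_bounded; [|apply sqrt_pos].
intros K; rewrite pow2_sqrt by lra.
apply Rle_trans with (e ^ 2 / 4 + e ^ 2 / 4); [|lra].
apply (Rsum_le_tail _ d N); auto; try lra.
- intros n; apply pow2_ge_0.
- intros n; rewrite <- RtoC_minus, Cmod_R, pow2_abs.
  assert (H1 : bern s' n j <= d n) by (apply bern_domin; lra).
  assert (H2 : bern s n j <= d n) by (apply bern_domin; lra).
  generalize (bern_ge0 s' n j) (bern_ge0 s n j) (bern_le1 s' n j) (bern_le1 s n j).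
  intros; apply Rle_trans with (Rabs (bern s' n j - bern s n j)).
  + rewrite <- pow2_abs; generalize (Rabs_pos (bern s' n j - bern s n j)).
    assert (Rabs (bern s' n j - bern s n j) <= 1) by (apply Rabs_le; lra).
    nra.
  + apply Rabs_le; lra.
- apply Rlt_le, Rle_lt_trans with (2 := HFs').
  apply Rsum_le; intros n _; rewrite <- RtoC_minus, Cmod_R, pow2_abs.
  apply Rle_refl.
- intros m Hm; apply Rlt_le, Rle_lt_trans with (1 := Rle_abs _).
  exact (HN N m (le_n N) Hm).
Qed.

Lemma hausdorff_op_finite (s : R) (p : H2) (N : nat) : 0 < s <= 1 ->
  (forall n, (N < n)%nat -> taylor p n = RtoC 0) ->
  hausdorff_op s p = sum_n (fun j => scal (taylor p j) (bern_col_op s j)) N.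
Proof.
intros Hs Hp; apply taylor_inj, functional_extensionality; intros k.
rewrite taylor_hausdorff_op, taylor_sum_n by exact Hs.
rewrite <- (hausdorff_ge s _ k (max k N)) by lia.
rewrite (sum_n_zero_ge _ N) by
  (try lia; intros j Hj; rewrite Hp by exact Hj; apply Cmult_0_r).
apply sum_n_ext; intros j.
change (scal (taylor p j) (bern_col_op s j)) with
  (H2_scal (taylor p j) (bern_col_op s j)).
rewrite taylor_scal, taylor_bern_col_op by exact Hs; apply Cmult_comm.
Qed.

Lemma H2_tail (f : H2) (e : R) : 0 < e ->
  exists (r : H2) (N : nat), H2_norm r <= e /\
    forall n, (N < n)%nat -> taylor (minus f r) n = RtoC 0.
Proof.
intros He.
assert (He2 : 0 < e ^ 2) by now apply pow_lt.
destruct (Cauchy_ex_series (K := R_AbsRing) (V := R_CompleteNormedModule)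
  _ (taylor_sqsum f) (mkposreal _ He2)) as [N HN].
set (r := fun k => if (k <? N)%nat then RtoC 0 else taylor f k).
destruct (sqsum_bounded r e) as [H1 H2]; [|lra|].
{ intros m; destruct (le_lt_dec N m) as [Hm|Hm].
  - rewrite (sum_n_ext _ (fun k => if (k <? N)%nat then 0 else Cmod (taylor f k) ^ 2)).
    + rewrite <- (sum_n_m_truncate (G := R_AbelianMonoid)
        (fun k => Cmod (taylor f k) ^ 2)).
      apply Rlt_le, Rle_lt_trans with (1 := Rle_abs _).
      exact (HN N m (le_n N) Hm).
    + intros k; unfold r; destruct (k <? N)%nat; [|reflexivity].
      rewrite Cmod_0; apply pow_i; lia.
  - rewrite (sum_n_ext_loc _ (fun _ => 0)).
    + rewrite sum_n_const, Rmult_0_r; lra.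
    + intros k Hk; unfold r; destruct (Nat.ltb_spec k N); [|lia].
      rewrite Cmod_0; apply pow_i; lia. }
exists (of_taylor r), N; split.
- unfold H2_norm; now rewrite taylor_of_taylor.
- intros n Hn; rewrite taylor_minus, taylor_of_taylor by exact H1.
  unfold r; destruct (Nat.ltb_spec n N); [lia|ring].
Qed.

(** A polynomial part involves finitely many columns; the remainder is small uniformly because the
    operator norms are at most [B] on $[s/2,1]$. The tolerances add up as $e/3+e/6+e/6$. *)
Lemma hausdorff_op_continuous (f : H2) (s : R) : 0 < s < 1 ->
  continuous (fun s => hausdorff_op s f : H2_UniformSpace) s.
Proof.
intros Hs; apply filterlim_locally; intros e.
set (B := sqrt (/ (s / 2))).
assert (HB : 0 < B) by (apply sqrt_lt_R0, Rinv_0_lt_compat; lra).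
assert (He3 : 0 < e / 3) by (generalize (cond_pos e); lra).
destruct (H2_tail f (e / 3 / B / 2)) as [r [N [Hr Hp]]].
{ apply Rdiv_lt_0_compat; [now apply Rdiv_lt_0_compat|lra]. }
assert (Hbound : forall u, s / 2 <= u <= 1 ->
  H2_norm (hausdorff_op u r) <= e / 3 / 2).
{ intros u Hu; apply Rle_trans with (1 := norm_hausdorff_op u r ltac:(lra)).
  apply Rle_trans with (B * (e / 3 / B / 2)); [|apply Req_le; field; lra].
  apply Rmult_le_compat; auto using sqrt_pos, l2norm_ge0.
  - apply l2norm_ge0.
  - apply sqrt_le_1_alt, Rinv_le_contravar; lra. }
assert (Hc : continuous (fun u => sum_n (fun j =>
  scal (taylor (minus f r) j) (bern_col_op u j)) N : H2_UniformSpace) s).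
{ apply (continuous_sum_n (K := C_AbsRing) (V := H2_NormedModule)
    (fun u j => scal (taylor (minus f r) j) (bern_col_op u j))).
  intros n; apply (continuous_scal (K := C_AbsRing) (V := H2_NormedModule)).
  - apply continuous_const.
  - now apply bern_col_op_continuous. }
assert (Hd1 : 0 < Rmin (s / 2) (1 - s)) by (apply Rmin_glb_lt; lra).
generalize (filter_and _ _ (proj1 (filterlim_locally _ _) Hc (mkposreal _ He3))
  (locally_ball s (mkposreal _ Hd1))).
apply filter_imp; intros s' [Hs1 Hs'].
change (Rabs (s' - s) < Rmin (s / 2) (1 - s)) in Hs'.
apply Rabs_lt_between in Hs'.
generalize (Rmin_l (s / 2) (1 - s)) (Rmin_r (s / 2) (1 - s)); intros Hm1 Hm2.
rewrite <- !hausdorff_op_finite in Hs1 by (auto; lra).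
change (H2_norm (minus (hausdorff_op s' (minus f r))
  (hausdorff_op s (minus f r))) < e / 3) in Hs1.
change (H2_norm (minus (hausdorff_op s' f) (hausdorff_op s f)) < e).
replace (minus (hausdorff_op s' f) (hausdorff_op s f)) with
  (H2_plus (minus (hausdorff_op s' (minus f r)) (hausdorff_op s (minus f r)))
    (H2_plus (hausdorff_op s' r) (H2_scal (-1) (hausdorff_op s r)))).
- apply Rle_lt_trans with (1 := H2_norm_triangle _ _).
  generalize (H2_norm_triangle (hausdorff_op s' r) (H2_scal (-1) (hausdorff_op s r))).
  rewrite H2_norm_scal, Cmod_R, Rabs_left by lra.
  generalize (Hbound s' ltac:(lra)) (Hbound s ltac:(lra)); lra.
- rewrite !hausdorff_op_minus by lra.
  apply H2_ext; intros z _; unfold minus, plus, opp; simpl; ring.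
Qed.

(** * Powers of the Cesaro operator *)

Definition gamma_weight (beta : C) (t : R) : C :=
  (RtoC (exp (- t)) * Rcpow t (beta - 1))%C.

Lemma gamma_weight_parts (beta : C) (t : R) : gamma_weight beta t =
  (exp (- t + (Re beta - 1) * ln t) * cos (Im beta * ln t),
   exp (- t + (Re beta - 1) * ln t) * sin (Im beta * ln t)).
Proof.
unfold gamma_weight, Rcpow, Cexp; destruct beta as [x y].
unfold Cmult, Cminus, Cplus, Copp, RtoC, Re, Im; cbn [fst snd].
replace ((x + - (1)) * ln t - (y + - 0) * 0) with ((x - 1) * ln t) by ring.
replace ((x + - (1)) * 0 + (y + - 0) * ln t) with (y * ln t) by ring.
rewrite exp_plus; f_equal; ring.
Qed.

Lemma Cexp_plus (z w : C) : Cexp (z + w)%C = (Cexp z * Cexp w)%C.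
Proof.
destruct z as [a b], w as [c d].
unfold Cexp, Cmult, Cplus, RtoC, Re, Im; cbn [fst snd].
rewrite exp_plus, cos_plus, sin_plus; f_equal; ring.
Qed.

Lemma Cexp_R (x : R) : Cexp (RtoC x) = RtoC (exp x).
Proof.
unfold Cexp, Cmult, RtoC, Re, Im; cbn [fst snd].
rewrite cos_0, sin_0; f_equal; ring.
Qed.

Lemma Cmod_gamma_weight (beta : C) (t : R) :
  Cmod (gamma_weight beta t) = exp (- t + (Re beta - 1) * ln t).
Proof.
rewrite gamma_weight_parts; unfold Cmod; cbn [fst snd].
set (e := exp _); set (u := Im beta * ln t).
replace ((e * cos u) ^ 2 + (e * sin u) ^ 2) with
  (e ^ 2 * (Rsqr (sin u) + Rsqr (cos u))) by (unfold Rsqr; ring).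
rewrite sin2_cos2, Rmult_1_r; apply sqrt_pow2, Rlt_le, exp_pos.
Qed.

Lemma continuous_Cparts {U : UniformSpace} (f : U -> C) (x : U) :
  continuous (fun y => fst (f y)) x -> continuous (fun y => snd (f y)) x ->
  continuous (f : U -> C_UniformSpace) x.
Proof.
intros H1 H2; apply filterlim_locally; intros e.
generalize (filter_and _ _ (proj1 (filterlim_locally _ _) H1 e)
  (proj1 (filterlim_locally _ _) H2 e)).
apply filter_imp; intros y [Hy1 Hy2]; now split.
Qed.

Lemma gamma_weight_continuous (beta : C) (t : R) : 0 < t ->
  continuous (gamma_weight beta : R -> C_UniformSpace) t.
Proof.
intros Ht; apply (continuous_Cparts (gamma_weight beta)).
- apply continuous_ext with (fun t =>
    exp (- t + (Re beta - 1) * ln t) * cos (Im beta * ln t)).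
  { intros u; now rewrite gamma_weight_parts. }
  apply (ex_derive_continuous (fun t =>
    exp (- t + (Re beta - 1) * ln t) * cos (Im beta * ln t))).
  auto_derive; repeat split; lra.
- apply continuous_ext with (fun t =>
    exp (- t + (Re beta - 1) * ln t) * sin (Im beta * ln t)).
  { intros u; now rewrite gamma_weight_parts. }
  apply (ex_derive_continuous (fun t =>
    exp (- t + (Re beta - 1) * ln t) * sin (Im beta * ln t))).
  auto_derive; repeat split; lra.
Qed.

Lemma norm_C_R (z : C) : norm (K := R_AbsRing) (V := C_R_NormedModule) z = Cmod z.
Proof.
change (sqrt (Rabs (fst z) ^ 2 + Rabs (snd z) ^ 2) = Cmod z).
now rewrite !pow2_abs.
Qed.

Lemma CGamma_correct (beta : C) : 0 < Re beta ->
  is_RInt_gen (V := C_R_CompleteNormedModule) (gamma_weight beta)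
    (at_right 0) (Rbar_locally p_infty) (CGamma beta).
Proof.
intros Hb; apply (RInt_gen_correct (V := C_R_CompleteNormedModule)).
apply (ex_RInt_gen_gamma (V := C_R_CompleteNormedModule) _ (Re beta) 1); auto; try lra.
- intros t Ht; now apply gamma_weight_continuous.
- intros t Ht; apply Rle_trans with (1 := Req_le _ _ (norm_C_R (gamma_weight beta t))).
  rewrite Cmod_gamma_weight, Rmult_1_l.
  apply Rlt_le, exp_increasing; lra.
Qed.

(** For a real exponent the integrand is positive, so integrals over intervals containing $[1,2]$
    stay above a positive constant and cannot tend to 0. *)
Lemma CGamma_R_neq0 (x : R) : 0 < x -> CGamma (RtoC x) <> RtoC 0.
Proof.
intros Hx E.
assert (Hfst : is_linear (K := R_AbsRing) (U := C_R_NormedModule)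
  (V := R_NormedModule) (fun z : C => fst z)) by exact is_linear_fst.
set (g := fun t => exp (- t + (x - 1) * ln t)).
assert (Hg : is_RInt_gen g (at_right 0) (Rbar_locally p_infty) 0).
{ generalize (is_RInt_gen_linear _ _ _ _ _ _ _ Hfst (CGamma_correct (RtoC x) Hx)).
  rewrite E; apply is_RInt_gen_ext.
  apply filter_forall; intros ab t _; rewrite gamma_weight_parts.
  unfold g, RtoC, Re, Im; cbn [fst snd]; rewrite Rmult_0_l, cos_0; cring. }
assert (Hc : forall t, 0 < t -> continuous g t).
{ intros t Ht; apply (ex_derive_continuous g); unfold g.
  auto_derive; repeat split; lra. }
assert (Hex : forall a b, 0 < a -> 0 < b -> ex_RInt g a b).
{ intros a b Ha Hb; apply (ex_RInt_continuous (V := R_CompleteNormedModule)).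
  intros z Hz; apply Hc.
  apply Rlt_le_trans with (2 := proj1 Hz); now apply Rmin_glb_lt. }
assert (H12 : 0 < RInt g 1 2).
{ apply RInt_gt_0; [lra| |].
  - intros t _; apply exp_pos.
  - intros t Ht; apply Hc; lra. }
assert (HP : locally 0 (fun y => y < RInt g 1 2)) by now apply open_lt.
assert (H : filter_prod (at_right 0) (Rbar_locally p_infty)
  (fun ab => 0 < fst ab < 1 /\ 2 < snd ab)).
{ apply Filter_prod with (fun a => 0 < a < 1) (fun b => 2 < b); auto.
  - exists (mkposreal 1 Rlt_0_1); intros y Hy Hy0.
    change (Rabs (y - 0) < 1) in Hy; apply Rabs_lt_between in Hy; lra.
  - now exists 2. }
destruct (filter_ex _ (filter_and _ _ (Hg _ HP : filter_prod _ _ _) H))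
  as [[a b] [[y [Hy1 Hy2]] [Ha Hb]]].
cbn [fst snd] in *.
apply (is_RInt_unique (V := R_CompleteNormedModule)) in Hy1.
rewrite <- Hy1, <- (RInt_Chasles g a 1 b), <- (RInt_Chasles g 1 2 b) in Hy2
  by (apply Hex; lra).
assert (H1 : 0 <= RInt g a 1).
{ apply RInt_ge_0; [lra|apply Hex; lra|intros; apply Rlt_le, exp_pos]. }
assert (H2 : 0 <= RInt g 2 b).
{ apply RInt_ge_0; [lra|apply Hex; lra|intros; apply Rlt_le, exp_pos]. }
unfold plus in Hy2; simpl in Hy2; lra.
Qed.

(** The substitution $u=(m+1)t$ in the integrand. The inner factor [INR m + 1] is the Jacobian, kept
    apart to match [is_RInt_gen_scale]. *)
Lemma gamma_weight_scale (beta : C) (m : nat) (t : R) : 0 < t ->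
  (gamma_weight beta t * RtoC (exp (- t) ^ m))%C =
    (Rcpow (/ (INR m + 1)) beta * (RtoC (INR m + 1) *
      gamma_weight beta ((INR m + 1) * t)))%C.
Proof.
intros Ht; assert (Hm : 0 < INR m + 1) by (generalize (pos_INR m); lra).
set (c := INR m + 1) in *.
assert (Hexp : exp (- t) ^ m * exp (- t) = exp (- (c * t))).
{ unfold c; clear; induction m as [|m IH].
  - simpl; rewrite Rmult_1_l; f_equal; ring.
  - rewrite S_INR; simpl; rewrite Rmult_assoc, IH, <- exp_plus; f_equal; ring. }
unfold gamma_weight, Rcpow.
rewrite ln_Rinv, ln_mult, <- Hexp, RtoC_mult by lra.
assert (Hcexp : RtoC c = Cexp (RtoC (ln c))) by now rewrite Cexp_R, exp_ln.
rewrite Hcexp.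
replace ((beta - 1) * RtoC (ln t))%C with
  (beta * RtoC (- ln c) + (RtoC (ln c) + (beta - 1) * RtoC (ln c + ln t)))%C
  by (rewrite RtoC_plus, RtoC_opp; ring).
rewrite !Cexp_plus; ring.
Qed.

Lemma mult_R_linear (w : C) : is_linear (K := R_AbsRing) (U := C_R_NormedModule)
  (V := C_R_NormedModule) (fun z : C => (w * z)%C).
Proof.
apply Build_is_linear.
- intros z1 z2; apply Cmult_plus_distr_l.
- intros k z; rewrite !scal_R_Cmult; cring.
- exists (Cmod w + 1); split; [generalize (Cmod_ge_0 w); lra|].
  intros z; rewrite !norm_C_R, Cmod_mult; generalize (Cmod_ge_0 z); lra.
Qed.

Lemma moment_R_linear (m : nat) : is_linear (K := R_AbsRing)
  (U := H2_R_NormedModule) (V := C_R_NormedModule) (fun f => moment m (taylor f)).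
Proof.
destruct (moment_linear m) as [H1 H2 H3]; apply Build_is_linear.
- exact H1.
- intros k f; rewrite scal_R_Cmult; exact (H2 (RtoC k) f).
- destruct H3 as [B [HB H3]]; exists B; split; [exact HB|].
  intros f; rewrite norm_C_R; exact (H3 f).
Qed.

Lemma exp_opp_range_open (t : R) : 0 < t -> 0 < exp (- t) < 1.
Proof.
intros Ht; split; [apply exp_pos|].
rewrite <- exp_0; apply exp_increasing; lra.
Qed.

(** The integrand is bounded in norm by $\|f\|e^{-t/2}t^{\mathrm{Re}\,\beta-1}$, so the integral
    converges. The moment passes inside, where the semigroup acts as $e^{-tm}$ and rescaling leaves
    the Gamma integral. *)
Lemma Cesaro_pow_integral (beta : C) (f : H2) : 0 < Re beta ->
  exists I : H2, Cesaro_pow beta f = scal (/ CGamma beta)%C I /\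
    forall m, moment m (taylor I) =
      (CGamma beta * (Rcpow (/ (INR m + 1)) beta * moment m (taylor f)))%C.
Proof.
intros Hb.
set (h := fun t => scal (gamma_weight beta t) (hausdorff_op (exp (- t)) f) : H2).
assert (Hex : ex_RInt_gen (V := H2_R_CompleteNormedModule) h
  (at_right 0) (Rbar_locally p_infty)).
{ apply (ex_RInt_gen_gamma (V := H2_R_CompleteNormedModule) h
    (Re beta) (H2_norm f)); auto.
  - apply l2norm_ge0.
  - intros t Ht.
    apply (continuous_scal (K := C_AbsRing) (V := H2_NormedModule)
      (gamma_weight beta) (fun t => hausdorff_op (exp (- t)) f)).
    (* Passes from the product uniform structure on [C] to that of its absolute value. *)
    + intros P HP; apply (gamma_weight_continuous beta t Ht).
      now apply locally_C.
    + apply (continuous_comp (fun t => exp (- t))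
        (fun s => hausdorff_op s f : H2_UniformSpace)).
      * apply (ex_derive_continuous (fun t => exp (- t))).
        auto_derive; auto.
      * now apply hausdorff_op_continuous, exp_opp_range_open.
  - intros t Ht; generalize (exp_opp_range_open t Ht); intros Hs.
    change (H2_norm (H2_scal (gamma_weight beta t) (hausdorff_op (exp (- t)) f))
      <= H2_norm f * exp (- t / 2 + (Re beta - 1) * ln t)).
    rewrite H2_norm_scal, Cmod_gamma_weight.
    apply Rle_trans with (exp (- t + (Re beta - 1) * ln t) *
      (sqrt (/ exp (- t)) * H2_norm f)).
    + apply Rmult_le_compat_l; [apply Rlt_le, exp_pos|].
      apply norm_hausdorff_op; lra.
    + replace (sqrt (/ exp (- t))) with (exp (t / 2)).
      * rewrite <- Rmult_assoc, <- exp_plus, Rmult_comm.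
        apply Req_le; f_equal; f_equal; lra.
      * rewrite <- (sqrt_pow2 (exp (t / 2))) by (apply Rlt_le, exp_pos).
        f_equal; rewrite <- exp_Ropp; simpl; rewrite Rmult_1_r, <- exp_plus.
        f_equal; lra. }
destruct Hex as [I HI]; exists I; split.
- unfold Cesaro_pow; f_equal.
  apply (is_RInt_gen_unique (V := H2_R_CompleteNormedModule)).
  revert HI; apply is_RInt_gen_ext.
  generalize ends_pos; apply filter_imp; intros [a b] [Ha Hb']; cbn [fst snd] in *.
  intros t [Ht _].
  assert (Ht0 : 0 < t) by (apply Rlt_trans with (2 := Ht); now apply Rmin_glb_lt).
  unfold h; now rewrite adjoint_comp_op by lra.
- intros m; assert (Hm : 0 < INR m + 1) by (generalize (pos_INR m); lra).
  generalize (is_RInt_gen_linear _ _ _ _ _ _ _ (moment_R_linear m) HI); intros H1.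
  generalize (is_RInt_gen_linear _ _ _ _ _ _ _
    (mult_R_linear (Rcpow (/ (INR m + 1)) beta * moment m (taylor f)))
    (is_RInt_gen_scale _ (INR m + 1) _ Hm (CGamma_correct beta Hb))); intros H2.
  rewrite Cmult_comm.
  rewrite <- (is_RInt_gen_unique (V := C_R_CompleteNormedModule) _ _ H1).
  apply (is_RInt_gen_unique (V := C_R_CompleteNormedModule)).
  revert H2; apply is_RInt_gen_ext.
  generalize ends_pos; apply filter_imp; intros [a b] [Ha Hb']; cbn [fst snd] in *.
  intros t [Ht _].
  assert (Ht0 : 0 < t) by (apply Rlt_trans with (2 := Ht); now apply Rmin_glb_lt).
  unfold h.
  etransitivity; [|symmetry; exact (linear_scal _ (moment_linear m)
    (gamma_weight beta t) (hausdorff_op (exp (- t)) f))].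
  generalize (exp_opp_range_open t Ht0); intros Hs.
  cbv beta; rewrite taylor_hausdorff_op, moment_hausdorff by lra.
  change (scal (gamma_weight beta t) (RtoC (exp (- t) ^ m) * moment m (taylor f))%C)
    with (gamma_weight beta t * (RtoC (exp (- t) ^ m) * moment m (taylor f)))%C.
  rewrite Cmult_assoc, gamma_weight_scale by exact Ht0.
  rewrite scal_R_Cmult; cring.
Qed.

Lemma moment_scal (m : nat) (c : C) (f : H2) :
  moment m (taylor (scal c f)) = (c * moment m (taylor f))%C.
Proof. exact (linear_scal _ (moment_linear m) c f). Qed.

(** The integral [I] has the moments of [scal (CGamma beta) g], where [g] in [M] is the sum of the
    binomial series; hence it lies in [M]. *)
Lemma Lat_Cesaro_pow (M : H2 -> Prop) (beta : C) :
  0 < Re beta -> Lat Cesaro_op M -> Lat (Cesaro_pow beta) M.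
Proof.
intros Hb HM; split; [apply HM|]; intros f Hf.
destruct (Cesaro_pow_integral beta f Hb) as [I [-> HI]].
destruct (binom_series_op M beta f Hb HM Hf) as [g [Hg Hgm]].
destruct HM as [[_ [_ [Hs _]]] _].
replace I with (scal (CGamma beta) g); [now apply Hs, Hs|].
apply taylor_inj, moment_inj; intros m.
now rewrite moment_scal, Hgm, HI.
Qed.

Lemma moment_Cesaro_pow (x : R) (f : H2) (m : nat) : 0 < x ->
  moment m (taylor (Cesaro_pow (RtoC x) f)) =
    (RtoC (exp (x * - ln (INR m + 1))) * moment m (taylor f))%C.
Proof.
intros Hx; destruct (Cesaro_pow_integral (RtoC x) f Hx) as [I [-> HI]].
rewrite moment_scal, HI; unfold Rcpow.
rewrite ln_Rinv by (generalize (pos_INR m); lra).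
rewrite <- RtoC_mult, Cexp_R.
field; now apply CGamma_R_neq0.
Qed.

Lemma iter_Cesaro_pow (n : nat) (f : H2) : (1 <= n)%nat ->
  Nat.iter n (Cesaro_pow (RtoC (1 / INR n))) f = Cesaro_op f.
Proof.
intros Hn; assert (Hn' : 0 < INR n) by (apply lt_0_INR; lia).
assert (Hx : 0 < 1 / INR n) by (apply Rdiv_lt_0_compat; lra).
apply taylor_inj, moment_inj; intros m; rewrite moment_Cesaro_op.
assert (H : forall k, moment m (taylor (Nat.iter k (Cesaro_pow (RtoC (1 / INR n))) f)) =
  (RtoC (exp (INR k * (1 / INR n * - ln (INR m + 1)))) * moment m (taylor f))%C).
{ induction k as [|k IH].
  - simpl; rewrite Rmult_0_l, exp_0; ring.
  - simpl Nat.iter; rewrite moment_Cesaro_pow, IH, S_INR by exact Hx.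
    rewrite Rmult_plus_distr_r, Rmult_1_l, exp_plus, RtoC_mult; ring. }
rewrite H; f_equal; f_equal.
replace (INR n * (1 / INR n * - ln (INR m + 1))) with (- ln (INR m + 1))
  by (field; lra).
rewrite exp_Ropp, exp_ln; [reflexivity|generalize (pos_INR m); lra].
Qed.

Theorem mainTheorem10 :
  (forall M : H2 -> Prop, Lat Cesaro_op M ->
     forall beta : C, 0 < Re beta -> Lat (Cesaro_pow beta) M) /\
  (forall n : nat, (1 <= n)%nat ->
     forall M : H2 -> Prop,
       Lat Cesaro_op M <-> Lat (Cesaro_pow (RtoC (1 / INR n))) M).
Proof.
split.
- intros M HM beta Hb; now apply Lat_Cesaro_pow.
- intros n Hn M; split; intros HM.
  + apply Lat_Cesaro_pow; [|exact HM].
    apply Rdiv_lt_0_compat; [lra|apply lt_0_INR; lia].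
  + destruct HM as [HS HM]; split; [exact HS|].
    intros f Hf; rewrite <- (iter_Cesaro_pow n f Hn).
    (* The number of iterations is freed from the exponent [1 / INR n], which must stay fixed during
       the induction. *)
    generalize n at 1; intros k; induction k as [|k IH]; [exact Hf|now apply HM].
Qed.
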